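(* Let $D\colon BU\to\mathbb{R}^m$ be a stable operator satisfying (D1)–(D3), of the form $Dx=x(0)-\int_{-\infty}^0[d\nu(s)]\,x(s)$ (as in the context), and let $\widehat D\colon BU\to BU$ be the linear operator $(\widehat Dx)(s)=Dx_s$, $s\le0$ (which is invertible because $D$ is stable). Then the operator $D^*\colon BU\to\mathbb{R}^m$, $D^*x=(\widehat D^{-1}x)(0)$, is also stable and satisfies (D1)–(D3).
   Context: Notation. $\|\cdot\|$ is the maximum norm on $\mathbb{R}^m$. $X=C((-\infty,0],\mathbb{R}^m)$ carries the compact-open topology, given by the metric $\mathsf{d}(x,y)=\sum_{n\ge1}2^{-n}\frac{\|x-y\|_n}{1+\|x-y\|_n}$, $\|x\|_n=\sup_{s\in[-n,0]}\|x(s)\|$. $BU\subset X$ is the Banach space of bounded uniformly continuous functions with norm $\|x\|_\infty=\sup_{s\le0}\|x(s)\|$, and $B_r=\{x\in BU:\|x\|_\infty\le r\}$. For a continuous $x\colon(-\infty,a]\to\mathbb{R}^m$ and $t\le a$, $x_t\in X$ is defined by $x_t(s)=x(t+s)$, $s\le0$. Hypotheses on an operator $L\colon BU\to\mathbb{R}^m$: (D1) $L$ is linear and continuous for $\|\cdot\|_\infty$. (D2) For each $r>0$, the restriction $L\colon B_r\to\mathbb{R}^m$ is continuous for the compact-open topology on $B_r$. (D3) $L$ is atomic at $0$, i.e. in the representation $Lx=\int_{-\infty}^0[d\mu(s)]x(s)$ with $\mu=[\mu_{ij}]$ a matrix of real regular Borel measures of finite total variation (which exists by (D1)–(D2)),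 $\det[\mu_{ij}(\{0\})]\ne0$. For $D$ it is a standing normalization that $Dx=x(0)-\int_{-\infty}^0[d\nu(s)]\,x(s)$, where $\nu=[\nu_{ij}]_{i,j=1}^m$, each $\nu_{ij}$ is a real regular Borel measure on $(-\infty,0]$ with finite total variation, and $|\nu_{ij}|(\{0\})=0$. Stability: an operator $L$ satisfying (D1)–(D3) is stable if there is a continuous $c\colon[0,\infty)\to[0,\infty)$ with $\lim_{t\to\infty}c(t)=0$ such that, for each $\varphi\in BU$ with $L\varphi=0$, the solution $x$ of $Lx_t=0$ for $t\ge0$, $x_0=\varphi$, satisfies $\|x(t)\|\le c(t)\|\varphi\|_\infty$ for each $t\ge0$. (Here a solution is a continuous function $x\colon\mathbb{R}\to\mathbb{R}^m$; it exists and is unique.) *)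

(* Defs.v *)
From HB Require Import structures.
From mathcomp Require Import all_boot all_order all_algebra.
From mathcomp Require Import all_classical all_reals all_analysis.

Set Implicit Arguments.
Unset Strict Implicit.
Unset Printing Implicit Defensive.

Import Order.TTheory GRing.Theory Num.Theory.
Import numFieldNormedType.Exports.

Local Open Scope classical_set_scope.
Local Open Scope ring_scope.

Notation halfline R := (set_type `]-oo, (0 : R)]).

Section halfline.
Variable R : realType.

Lemma halfline_le0 (s : halfline R) : val s <= 0.
Proof. by case: s => s /=; rewrite inE /= in_itv. Qed.

Lemma in_halfline (s : R) : s <= 0 -> s \in `]-oo, (0 : R)]%classic.
Proof. by move=> s0; rewrite inE /= in_itv. Qed.

Definition halfline_mk (s : R) (s0 : s <= 0) : halfline R :=
  exist _ s (in_halfline s0).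

Definition halfline0 : halfline R := halfline_mk (lexx 0).

HB.instance Definition _ := isPointed.Build (halfline R) halfline0.

Lemma halfline_add_le0 (s t : halfline R) : val s + val t <= 0.
Proof. by rewrite -[leRHS]addr0 lerD ?halfline_le0. Qed.

Definition halfline_add (s t : halfline R) : halfline R :=
  halfline_mk (halfline_add_le0 s t).

End halfline.

Section BU.
Variables (R : realType) (m : nat).
Local Notation H := (halfline R).
Local Notation V := 'cV[R]_m.

Definition is_bu : {pred (H -> V)} :=
  [pred x : H -> V | `[< bounded_fun x /\ unif_continuous x >]].

Lemma is_buP (x : H -> V) :
  reflect ((exists M, forall s, `|x s| <= M) /\
    forall e, 0 < e -> exists2 d, 0 < d &
      forall s t : H, `|val s - val t| < d -> `|x s - x t| < e)
  (x \in is_bu).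
Proof.
apply: (iffP idP) => [/asboolP[bx ux]|[[M xM] ux]].
  split.
    have [M _ xM] := ex_strict_bound_gt0 bx.
    by exists M => s; apply/ltW/xM.
  move=> e e0; have [d d0 xd] := (unif_continuousP x).1 ux _ e0.
  exists d => // s t st.
  by have := xd (s, t) st; rewrite -ball_normE.
apply/asboolP; split.
  exists M; split; first exact: num_real.
  by move=> N MN s _; exact/(le_trans (xM s))/ltW.
apply/unif_continuousP => e e0; have [d d0 xd] := ux _ e0.
by exists d => // -[s t] st /=; rewrite -ball_normE; exact: xd.
Qed.

Lemma is_bu_submod_closed : submod_closed is_bu.
Proof.
split.
  apply/is_buP; split; first by exists 0 => s; rewrite normr0.
  by move=> e e0; exists 1 => // s t _; rewrite subrr normr0.
move=> a x y /is_buP[[M xM] ux] /is_buP[[N yN] uy]; apply/is_buP; split.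
  exists (`|a| * M + N) => s.
  by rewrite (le_trans (ler_normD _ _))// normrZ lerD ?ler_wpM2l.
move=> e e0.
have a1 : 0 < `|a| + 1 by rewrite ltr_wpDl.
have e1 : 0 < e / 2 / (`|a| + 1) by rewrite !divr_gt0.
have [d d0 xd] := ux _ e1.
have e2 : 0 < e / 2 by rewrite divr_gt0.
have [d' d'0 yd] := uy _ e2.
exists (Num.min d d'); first by rewrite lt_min d0.
move=> s t; rewrite lt_min => /andP[/xd xst /yd yst].
rewrite [X in `|X|](_ : _ = a *: (x s - x t) + (y s - y t)); last first.
  by rewrite scalerBr opprD addrACA.
rewrite (le_lt_trans (ler_normD _ _))// [ltRHS]splitr ler_ltD// normrZ.
have := ltW xst; rewrite ler_pdivlMr// mulrC; apply: le_trans.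
by rewrite ler_wpM2r// lerDl.
Qed.

HB.instance Definition _ :=
  GRing.isSubmodClosed.Build _ _ is_bu is_bu_submod_closed.

Record BU := BUMk { bu_fun :> H -> V; bu_funP : bu_fun \in is_bu }.

HB.instance Definition _ := [isSub for bu_fun].
HB.instance Definition _ := [Choice of BU by <:].
HB.instance Definition _ := [SubChoice_isSubLmodule of BU by <:].

(* `|x s| is the maximum norm of 'cV[R]_m. *)
Definition bu_norm (x : BU) : R := sup [set `|x s| | s in [set: H]].

Lemma bu_norm_ge (x : BU) s : `|x s| <= bu_norm x.
Proof.
apply: ub_le_sup; last by exists s.
have /is_buP[[M xM] _] := bu_funP x.
by exists M => _ [t _ <-].
Qed.

Lemma bu_norm_le (x : BU) M : (forall s, `|x s| <= M) -> bu_norm x <= M.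
Proof.
move=> xM; apply: ge_sup; first by exists `|x (halfline0 R)|, (halfline0 R).
by move=> _ [t _ <-].
Qed.

Lemma bu_normD x y : bu_norm (x + y) <= bu_norm x + bu_norm y.
Proof.
apply: bu_norm_le => s.
by rewrite (le_trans (ler_normD _ _))// lerD ?bu_norm_ge.
Qed.

Lemma bu_norm_ge0 x : 0 <= bu_norm x.
Proof. exact: le_trans (bu_norm_ge x (halfline0 R)). Qed.

Lemma bu_normZ a x : bu_norm (a *: x) = `|a| * bu_norm x.
Proof.
have le b y : bu_norm (b *: y) <= `|b| * bu_norm y.
  by apply: bu_norm_le => s; rewrite normrZ ler_wpM2l// bu_norm_ge.
apply/eqP; rewrite eq_le le /=.
have [->|a0] := eqVneq a 0; first by rewrite normr0 mul0r bu_norm_ge0.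
rewrite -ler_pdivlMl ?normr_gt0// -normfV.
by apply: le_trans (le _ _); rewrite scalerA mulVf// scale1r.
Qed.

Lemma bu_norm0_eq0 x : bu_norm x = 0 -> x = 0.
Proof.
move=> x0; apply/val_inj/funext => s /=; apply/eqP.
by rewrite -normr_le0 -x0; exact: bu_norm_ge.
Qed.

HB.instance Definition _ :=
  Lmodule_isNormed.Build R BU bu_normD bu_normZ bu_norm0_eq0.

Lemma bu_normE (x : BU) : `|x| = sup [set `|x s| | s in [set: H]].
Proof. by []. Qed.

Lemma shift_is_bu (x : BU) (s : H) : (fun u => x (halfline_add s u)) \in is_bu.
Proof.
have /is_buP[[M xM] ux] := bu_funP x; apply/is_buP; split.
  by exists M.
move=> e /ux[d d0 xd]; exists d => // u v uv.
by apply: xd; rewrite /= opprD addrACA subrr add0r.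
Qed.

Definition bu_shift (x : BU) (s : H) : BU := BUMk (shift_is_bu x s).

(* Continuity refers to the norm topology of BU, declared just above. *)
Definition D1 (L : BU -> V) := linear L /\ continuous L.

(* BU again, with the topology induced by X = C((-oo, 0], R^m), which does not
   clash with the norm topology since it lives on this alias. *)
Definition bu_compact_open : Type :=
  initial_topology (bu_fun : BU -> {compact-open, H -> V}).

HB.instance Definition _ := Topological.on bu_compact_open.

Definition D2 (L : BU -> V) := forall r : R, 0 < r ->
  {within ([set x : BU | `|x| <= r] : set bu_compact_open),
    continuous (L : bu_compact_open -> V)}.

Lemma D1_bounded (L : BU -> V) : D1 L -> exists M, forall x, `|L x| <= M * `|x|.
Proof.
move=> [linL cL].
pose f : {linear BU -> V} := HB.pack L (GRing.isLinear.Build _ _ _ _ L linL).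
have /linear_boundedP/pinfty_ex_gt0[M _ LM] : bounded_near f (nbhs 0).
  by apply: continuous_linear_bounded; exact: cL.
by exists M.
Qed.

Lemma hat_is_bu (L : BU -> V) (hL : D1 L) (x : BU) :
  (fun s => L (bu_shift x s)) \in is_bu.
Proof.
have [M LM] := D1_bounded hL.
have {LM} : exists2 M, 0 < M & forall y, `|L y| <= M * `|y|.
  exists (`|M| + 1); first by rewrite ltr_wpDl.
  move=> y; rewrite (le_trans (LM y))// ler_wpM2r//.
  by rewrite (le_trans (ler_norm M))// lerDl.
move=> [{}M M0 LM].
have [linL _] := hL.
have LB y z : L y - L z = L (y - z).
  have := linL (-1) z y; rewrite !scaleN1r [- _ + y]addrC => ->.
  by rewrite addrC.
have /is_buP[[N xN] ux] := bu_funP x; apply/is_buP; split.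
  exists (M * N) => s; rewrite (le_trans (LM _))// ler_wpM2l ?(ltW M0)//.
  by apply: (@bu_norm_le (bu_shift x s)) => u; exact: xN.
move=> e e0; have eM : 0 < e / M / 2 by rewrite !divr_gt0.
have [d d0 xd] := ux _ eM.
exists d => // s t st; rewrite LB (le_lt_trans (LM _))//.
rewrite -ltr_pdivlMl// mulrC.
apply: (@le_lt_trans _ _ (e / M / 2)); last first.
  by rewrite ltr_pdivrMr// ltr_pMr ?divr_gt0// ltr1n.
apply: (@bu_norm_le (bu_shift x s - bu_shift x t)) => u; apply/ltW; apply: xd => /=.
by rewrite opprD addrACA subrr addr0.
Qed.

(* (hat L x)(s) = L x_s *)
Definition hat (L : BU -> V) (hL : D1 L) (x : BU) : BU :=
  BUMk (hat_is_bu hL x).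

(* A real Borel measure on (-oo, 0] is a charge on the sigma-algebra generated
   by the open sets. Charges are finite-valued, so their total variation is
   finite. Integrals and variation are taken through a chosen Hahn
   decomposition; they do not depend on it (Hahn_decomposition_uniq). *)
Local Notation B := (g_sigma_algebraType (@open H)).

Definition hahn_pos_set (nu : {charge set B -> \bar R}) : set B :=
  sval (cid (Hahn_decomposition nu)).

Definition hahn_neg_set (nu : {charge set B -> \bar R}) : set B :=
  sval (cid (svalP (cid (Hahn_decomposition nu)))).

Definition hahn (nu : {charge set B -> \bar R}) :
    hahn_decomposition nu (hahn_pos_set nu) (hahn_neg_set nu) :=
  svalP (cid (svalP (cid (Hahn_decomposition nu)))).

Definition total_variation (nu : {charge set B -> \bar R}) : set B -> \bar R :=
  charge_variation (hahn nu).

Definition charge_integral (nu : {charge set B -> \bar R}) (f : H -> R) : R :=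
  (\int[jordan_pos (hahn nu)]_s f s) - (\int[jordan_neg (hahn nu)]_s f s).

(* Regularity of the total variation measure. *)
Definition regular_charge (nu : {charge set B -> \bar R}) :=
  forall A : set B, measurable A -> forall e : R, 0 < e ->
    exists K U : set H, [/\ compact K, open U, K `<=` A, A `<=` U &
      (total_variation nu (U `\` K : set B) < e%:E)%E].

(* \int [d nu(s)] x(s), with the matrix nu acting on the column x(s). *)
Definition mx_integral (nu : 'I_m -> 'I_m -> {charge set B -> \bar R})
    (x : H -> V) : V :=
  \col_i \sum_j charge_integral (nu i j) (fun s => x s j 0).

Definition D3 (L : BU -> V) :=
  exists mu : 'I_m -> 'I_m -> {charge set B -> \bar R},
    [/\ forall i j, regular_charge (mu i j),
        forall x, L x = mx_integral mu x &
        \det (\matrix_(i, j) fine (mu i j [set halfline0 R])) != 0].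

Definition normalized (D : BU -> V) :=
  exists nu : 'I_m -> 'I_m -> {charge set B -> \bar R},
    [/\ forall i j, regular_charge (nu i j),
        forall i j, total_variation (nu i j) [set halfline0 R] = 0%E &
        forall x : BU, D x = x (halfline0 R) - mx_integral nu x].

(* The segment x_t. *)
Definition history (x : R -> V) (t : R) : H -> V := fun s => x (t + val s).

(* L only acts on BU: the element y below is x_t as a member of BU. It is
   unique, and it always exists when x is continuous and x_0 = phi is in BU,
   as x is then bounded and uniformly continuous on (-oo, t]. *)
Definition is_solution (L : BU -> V) (phi : BU) (x : R -> V) :=
  [/\ continuous x,
      history x 0 = phi &
      forall t, 0 <= t -> exists2 y : BU, bu_fun y = history x t & L y = 0].

Definition stable (L : BU -> V) :=
  exists c : R -> R,
    [/\ {within `[0, +oo[, continuous c},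
        forall t, 0 <= t -> 0 <= c t,
        c t @[t --> +oo] --> 0 &
        forall phi, L phi = 0 -> forall x, is_solution L phi x ->
          forall t, 0 <= t -> `|x t| <= c t * `|phi|].

End BU.

(* Main.v *)
(** Write D^ = hat D.  As the measures defining [x - D x] do not charge 0, the
    operator 1 - D^ is a contraction on the functions supported in a short
    interval [-d, 0], so D^ is invertible there, and by steps on the functions
    supported in [-T, 0] for every T.  Stability turns this into an estimate
    |z| <= K |D^ z| valid for all z: cut D^ z off before -T, solve for the
    cut-off right-hand side, and note that the difference is a homogeneous
    solution on [-T, 0], hence at 0 at most c(T) times its norm.  Then D* x is
    the limit, along wider and wider cut-offs of x, of the value at 0 of the
    solutions; stability gives its convergence and the tightness of D*, which
    together with (D1) is equivalent to (D2).  If D* x_t = 0 for t >= 0 and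
    y = D^^-1 x_t then y = 0 on [-t, 0] and x(t) = D y, so that the stability of
    D* is the tightness of D.  The measures representing D* come from a Riesz
    theorem for tight functionals, and their atoms at 0 form the identity
    matrix because D y = y(0) + o(1) |y| when y is supported near 0. *)

Require Import Defs.
From HB Require Import structures.
From mathcomp Require Import all_boot all_order all_algebra.
From mathcomp Require Import all_classical all_reals all_analysis.
From mathcomp Require Import measurable_realfun lra ring.

Set Implicit Arguments.
Unset Strict Implicit.
Unset Printing Implicit Defensive.

Import Order.TTheory GRing.Theory Num.Theory.
Import numFieldNormedType.Exports.

Local Open Scope classical_set_scope.
Local Open Scope ring_scope.

(** Cut-offs of a member of [BU] converge to it uniformly on compact sets only, so the bound |z| <=
    K |D^ z| does not extend the inverse of D^ by density from the functions supported in some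
    [-T, 0] to all of [BU]. The inverse is therefore obtained at the single point 0, as a limit with
    explicit error c(n), and carried to the other points by the commutation of D^ with shifts. That
    the result really inverts D^ then rests on the continuity of D for the compact-open topology,
    handled as tightness: on the unit ball, D is uniformly small on the functions that vanish on a
    long interval [-T, 0]. Another obstacle is that [stable] speaks of solutions on the whole real
    line, while the estimates concern functions on the half-line that are homogeneous on [-T, 0]
    only; these must be prolonged to all forward times before stability applies to them. As the
    half-line is not compact, tightness is also what keeps mass from escaping to -oo in the Riesz
    theorem. Since the half-line is one-dimensional, the measure can be built from a distribution
    function, after a Jordan decomposition of the functional. *)

Section halfline_extra.
Variable R : realType.
Local Notation H := (halfline R).

Lemma minr0_le0 (t : R) : Num.min t 0 <= 0.
Proof. by rewrite ge_min lexx orbT. Qed.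

(** A 1-Lipschitz retraction of the real line onto the half-line: points can be written without
    carrying a proof of their sign. *)
Definition hl (t : R) : H := halfline_mk (minr0_le0 t).

Lemma val_hl t : val (hl t) = Num.min t 0.
Proof. by []. Qed.

Lemma val_add (s t : H) : val (halfline_add s t) = val s + val t.
Proof. by []. Qed.

Lemma val_hl_le0 t : t <= 0 -> val (hl t) = t.
Proof. by move=> t0; rewrite val_hl min_l. Qed.

Lemma hlK s : hl (val s) = s.
Proof. by apply/val_inj; rewrite val_hl_le0// halfline_le0. Qed.

Lemma hl0 : hl 0 = halfline0 R.
Proof. by apply/val_inj; rewrite /= minxx. Qed.

Lemma hl_lip t u : `|val (hl t) - val (hl u)| <= `|t - u|.
Proof.
rewrite /= /Num.min; case: ifPn; case: ifPn; rewrite -?leNgt => u0 t0;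
  rewrite ?ler_norml ?subrr ?normr0; have := ler_norm (t - u);
    have := ler_norm (u - t); rewrite distrC; lra.
Qed.

Definition lip1 (p : H -> H) :=
  forall s t, `|val (p s) - val (p t)| <= `|val s - val t|.

Lemma lip1_shift (a : R) : lip1 (fun s => hl (val s + a)).
Proof.
by move=> s t; apply: le_trans (hl_lip _ _) _;
  rewrite opprD addrACA subrr addr0.
Qed.

Lemma maxr_lip (a t u : R) : `|Num.max a t - Num.max a u| <= `|t - u|.
Proof.
rewrite /Num.max; case: ifPn; case: ifPn; rewrite -?leNgt => u0 t0;
  rewrite ?ler_norml ?subrr ?normr0; have := ler_norm (t - u);
    have := ler_norm (u - t); rewrite distrC; lra.
Qed.

Lemma minr_lip (a t u : R) : `|Num.min a t - Num.min a u| <= `|t - u|.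
Proof.
rewrite /Num.min; case: ifPn; case: ifPn; rewrite -?leNgt => u0 t0;
  rewrite ?ler_norml ?subrr ?normr0; have := ler_norm (t - u);
    have := ler_norm (u - t); rewrite distrC; lra.
Qed.

Lemma lip1_max (a : R) : lip1 (fun s => hl (Num.max a (val s))).
Proof. move=> s t; exact: le_trans (hl_lip _ _) (maxr_lip _ _ _). Qed.

(** For T >= 0 it is 1 on [-T, 0] and 0 before -T - 1. The sloped unit interval keeps products in
    [BU], and is why [T + 1] appears wherever [bu_cut T] is used. *)
Definition cutoff (T : R) (s : H) : R := Num.max 0 (Num.min 1 (val s + T + 1)).

Lemma cutoff_lip T s t : `|cutoff T s - cutoff T t| <= `|val s - val t|.
Proof.
rewrite (le_trans (maxr_lip _ _ _))// (le_trans (minr_lip _ _ _))//.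
by rewrite le_eqVlt; apply/orP; left; apply/eqP; congr `|_|; ring.
Qed.

Lemma cutoff_ge0 T s : 0 <= cutoff T s.
Proof. by rewrite le_max lexx. Qed.

Lemma cutoff_le1 T s : cutoff T s <= 1.
Proof. by rewrite ge_max ler01 ge_min lexx. Qed.

Lemma cutoff1 T s : - T <= val s -> cutoff T s = 1.
Proof. by move=> sT; rewrite /cutoff min_l ?max_r//; lra. Qed.

Lemma cutoff0 T s : val s <= - T - 1 -> cutoff T s = 0.
Proof. by move=> sT; rewrite /cutoff max_l// ge_min; apply/orP; right; lra. Qed.

End halfline_extra.

(** * Cut-offs, shifts and the operator [hat] on [BU] *)

Section BU_ops.
Variables (R : realType) (m : nat).
Local Notation H := (halfline R).
Local Notation V := 'cV[R]_m.
Local Notation BU := (BU R m).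
Implicit Types (x y z : BU) (s t : H).

Lemma bu_ext x y : (forall s, x s = y s) -> x = y.
Proof. by move=> xy; apply/val_inj/funext. Qed.

Lemma bu_ge x s : `|x s| <= `|x|.
Proof. exact: bu_norm_ge. Qed.

Lemma bu_le x M : (forall s, `|x s| <= M) -> `|x| <= M.
Proof. exact: bu_norm_le. Qed.

Lemma bu_unif x e : 0 < e -> exists2 d, 0 < d &
  forall s t, `|val s - val t| < d -> `|x s - x t| < e.
Proof. by move=> e0; have /is_buP[_ /(_ _ e0)] := bu_funP x. Qed.

Lemma bu_comp_subproof x (p : H -> H) (hp : lip1 p) : x \o p \in @is_bu R m.
Proof.
apply/is_buP; split; first by exists `|x| => s; exact: (bu_ge x (p s)).
move=> e /(bu_unif x)[d d0 xd]; exists d => // s t st.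
by apply: xd; apply: le_lt_trans st; exact: hp.
Qed.

Definition bu_comp x p hp : BU := BUMk (@bu_comp_subproof x p hp).

Lemma bu_comp_le x p hp : `|@bu_comp x p hp| <= `|x|.
Proof. by apply: bu_le => s; exact: (bu_ge x). Qed.

Lemma bu_cut_subproof x T : (fun s => cutoff T s *: x s) \in @is_bu R m.
Proof.
apply/is_buP; split.
  exists `|x| => s; rewrite normrZ ger0_norm ?cutoff_ge0//.
  by rewrite (le_trans _ (bu_ge x s))// ler_piMl// cutoff_le1.
move=> e e0; have e2 : 0 < e / 2 by rewrite divr_gt0.
have [d d0 xd] := bu_unif x e2.
have x1 : 0 < `|x| + 1 by rewrite ltr_wpDl.
exists (Num.min d (e / 2 / (`|x| + 1))).
  by rewrite lt_min d0 !divr_gt0.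
move=> s t; rewrite lt_min => /andP[/xd xst]; rewrite ltr_pdivlMr// => st.
rewrite [X in `|X|](_ : _ = (cutoff T s - cutoff T t) *: x s +
    cutoff T t *: (x s - x t)); last first.
  by rewrite scalerBl scalerBr addrA subrK.
rewrite (le_lt_trans (ler_normD _ _))// [ltRHS]splitr ltrD// normrZ.
  apply: le_lt_trans st; rewrite ler_pM// ?cutoff_lip//.
  by rewrite (le_trans (bu_ge _ _))// lerDl.
apply: le_lt_trans xst.
by rewrite ger0_norm ?cutoff_ge0// ler_piMl// cutoff_le1.
Qed.

Definition bu_cut T x : BU := BUMk (bu_cut_subproof x T).

Lemma bu_cut_le T x : `|bu_cut T x| <= `|x|.
Proof.
apply: bu_le => s /=; rewrite normrZ ger0_norm ?cutoff_ge0//.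
by rewrite (le_trans _ (bu_ge x s))// ler_piMl// cutoff_le1.
Qed.

Lemma bu_cutD T x y : bu_cut T (x + y) = bu_cut T x + bu_cut T y.
Proof. by apply: bu_ext => s /=; rewrite scalerDr. Qed.

Lemma bu_cutZ T a x : bu_cut T (a *: x) = a *: bu_cut T x.
Proof.
apply: bu_ext => s.
rewrite -[LHS]/(_ *: (a *: x s)) -[RHS]/(a *: (_ *: x s)).
by rewrite !scalerA mulrC.
Qed.

Lemma bu_shiftE x s u : bu_shift x s u = x (halfline_add s u).
Proof. by []. Qed.

Lemma bu_shiftD x y s : bu_shift (x + y) s = bu_shift x s + bu_shift y s.
Proof. exact: bu_ext. Qed.

Lemma bu_shiftB x y s : bu_shift (x - y) s = bu_shift x s - bu_shift y s.
Proof. exact: bu_ext. Qed.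

Lemma bu_shiftZ a x s : bu_shift (a *: x) s = a *: bu_shift x s.
Proof. exact: bu_ext. Qed.

Lemma bu_shift_shift x s t :
  bu_shift (bu_shift x s) t = bu_shift x (halfline_add s t).
Proof.
by apply: bu_ext => u /=; congr (x _); apply/val_inj => /=; rewrite addrA.
Qed.

Lemma bu_shift0 x : bu_shift x (halfline0 R) = x.
Proof.
by apply: bu_ext => u /=; congr (x _); apply/val_inj => /=; rewrite add0r.
Qed.

Lemma bu_shift_le x s : `|bu_shift x s| <= `|x|.
Proof. by apply: bu_le => u; exact: (bu_ge x). Qed.

Lemma halfline_add0 s : halfline_add s (halfline0 R) = s.
Proof. by apply/val_inj; rewrite /= addr0. Qed.

Definition zero_after T x := forall s, - T <= val s -> x s = 0.
Definition zero_before T x := forall s, val s <= - T -> x s = 0.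

Definition tight (L : BU -> V) := forall e, 0 < e ->
  exists2 T, 0 <= T & forall x, zero_after T x -> `|L x| <= e * `|x|.

Section D1_theory.
Variables (L : BU -> V) (hL : D1 L).

Lemma D1D x y : L (x + y) = L x + L y.
Proof. by have [lL _] := hL; have := lL 1 x y; rewrite !scale1r. Qed.

Lemma D1_0 : L 0 = 0.
Proof. by apply: (@addrI _ (L 0)); rewrite -D1D !addr0. Qed.

Lemma D1Z a x : L (a *: x) = a *: L x.
Proof. by have [lL _] := hL; have := lL a x 0; rewrite D1_0 !addr0. Qed.

Lemma D1N x : L (- x) = - L x.
Proof. by rewrite -scaleN1r D1Z scaleN1r. Qed.

Lemma D1B x y : L (x - y) = L x - L y.
Proof. by rewrite D1D D1N. Qed.

Lemma D1_bound : exists2 M, 0 < M & forall x, `|L x| <= M * `|x|.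
Proof.
have [M LM] := D1_bounded hL.
exists (`|M| + 1); first by rewrite ltr_wpDl.
move=> x; rewrite (le_trans (LM x))// ler_wpM2r//.
by rewrite (le_trans (ler_norm M))// lerDl.
Qed.

Lemma hatE x s : hat hL x s = L (bu_shift x s).
Proof. by []. Qed.

Lemma hatD x y : hat hL (x + y) = hat hL x + hat hL y.
Proof. by apply: bu_ext => s; rewrite !hatE bu_shiftD D1D. Qed.

Lemma hatZ a x : hat hL (a *: x) = a *: hat hL x.
Proof. by apply: bu_ext => s; rewrite !hatE bu_shiftZ D1Z. Qed.

Lemma hatB x y : hat hL (x - y) = hat hL x - hat hL y.
Proof. by apply: bu_ext => s; rewrite !hatE bu_shiftB D1B. Qed.

Lemma hat_shift x s : hat hL (bu_shift x s) = bu_shift (hat hL x) s.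
Proof. by apply: bu_ext => t; rewrite hatE bu_shift_shift. Qed.

Lemma hat_0 x : hat hL x (halfline0 R) = L x.
Proof. by rewrite hatE bu_shift0. Qed.

End D1_theory.

Lemma bounded_D1 (L : BU -> V) M :
  linear L -> (forall x, `|L x| <= M * `|x|) -> D1 L.
Proof.
move=> lL LM; split=> //.
pose f : {linear BU -> V} := HB.pack L (GRing.isLinear.Build _ _ _ _ L lL).
apply: (@bounded_linear_continuous R BU V f); apply/linear_boundedP.
apply: filterS (nbhs_pinfty_ge (num_real M)) => r Mr x.
exact: le_trans (LM x) (ler_wpM2r (normr_ge0 x) Mr).
Qed.

End BU_ops.

(** * Limits with a rate; completeness of [BU] *)

Lemma cvgn_le_cst (R : realFieldType) (u : nat -> R) l c N :
  u n @[n --> \oo] --> l -> (forall n, (N <= n)%N -> u n <= c) -> l <= c.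
Proof.
move=> ul uc; rewrite -(cvg_lim (@Rhausdorff R) ul).
by apply: limr_le; [apply/cvg_ex; exists l|exists N].
Qed.

(** The rate passes to the limit unchanged. Later estimates use it with an explicit [e], and a rate
    common to all points makes pointwise limits uniform. *)
Lemma cauchy_rate_lim (R : realType) (m : nat)
    (u : nat -> 'cV[R]_m) (e : nat -> R) :
  e n @[n --> \oo] --> 0 -> (forall n k, `|u (n + k)%N - u n| <= e n) ->
  exists l, forall n, `|l - u n| <= e n.
Proof.
move=> e0 ue.
have cu : cvgn u.
  apply/cauchy_cvgP/cauchy_exP => eps eps0.
  have /cvgrPdist_lt/(_ _ eps0)[N _ NE] := e0.
  exists (u N); exists N => // k /= Nk.
  rewrite -ball_normE /= distrC -(subnKC Nk).
  apply: le_lt_trans (ue _ _) _; have := NE N (leqnn N).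
  by rewrite sub0r normrN; apply: le_lt_trans; exact: ler_norm.
exists (limn u) => n.
apply: (@cvgn_le_cst _ (fun k => `|u k - u n|) _ _ n); last first.
  by move=> k nk; rewrite -(subnKC nk); exact: ue.
by apply: cvg_norm; apply: cvgB; [exact: cu|exact: cvg_cst].
Qed.

Lemma bu_lim (R : realType) (m : nat) (u : nat -> BU R m) (e : nat -> R) :
  e n @[n --> \oo] --> 0 -> (forall n k, `|u (n + k)%N - u n| <= e n) ->
  exists z, forall n, `|z - u n| <= e n.
Proof.
move=> e0 ue.
have /choice[z ze] s : exists l, forall n, `|l - u n s| <= e n.
  apply: (cauchy_rate_lim e0) => n k.
  exact: le_trans (bu_ge (u (n + k)%N - u n) s) (ue n k).
have zb : z \in @is_bu R m.
  apply/is_buP; split.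
    exists (e 0%N + `|u 0%N|) => s.
    rewrite -[z s](subrK (u 0%N s)) (le_trans (ler_normD _ _))// lerD//.
    exact: bu_ge.
  move=> eps eps0; have eps3 : 0 < eps / 3 by rewrite divr_gt0.
  have /cvgrPdist_lt/(_ _ eps3)[N _ NE] := e0.
  have {NE}eN : e N < eps / 3.
    have := NE N (leqnn N).
    by rewrite sub0r normrN; apply: le_lt_trans; exact: ler_norm.
  have [d d0 ud] := bu_unif (u N) eps3.
  exists d => // s t st.
  rewrite [X in `|X|](_ : _ = (z s - u N s) + (u N s - u N t) - (z t - u N t));
    last first.
    by rewrite opprB !addrA !subrK.
  have -> : eps = eps / 3 + eps / 3 + eps / 3 by field.
  rewrite (le_lt_trans (ler_normB _ _))// ltrD// ?(le_lt_trans (ze _ _))//.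
  by rewrite (le_lt_trans (ler_normD _ _))// ltrD// ?(le_lt_trans (ze _ _))//
    ud.
exists (BUMk zb) => n; apply: bu_le => s; exact: (ze s).
Qed.

(** * Tightness and the compact-open topology *)

Section compact_open_tight.
Variables (R : realType) (m : nat).
Local Notation H := (halfline R).
Local Notation V := 'cV[R]_m.
Local Notation BU := (BU R m).

Lemma continuous_val_halfline : continuous (val : H -> R).
Proof. exact: initial_continuous. Qed.

Lemma continuous_hl : continuous (@hl R).
Proof.
move=> t; apply/cvg_ballP => e e0; near=> u.
have : `|t - u| < e by near: u; exact: (@cvgr_dist_lt _ R^o).
rewrite -[X in _ -> X]/(ball (val (hl t)) e (val (hl u))) -ball_normE.
exact/le_lt_trans/hl_lip.
Unshelve. all: by end_near. Qed.

Lemma continuous_bu (x : BU) : continuous x.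
Proof.
move=> s; apply/(@cvgrPdist_lt R V H (nbhs s) (nbhs_filter s)) =>
  e /(bu_unif x)[d d0 xd].
have vs : val u @[u --> s] --> val s by exact: continuous_val_halfline.
have := vs; move/(@cvgrPdist_lt R R H (nbhs s) (nbhs_filter s)) => /(_ _ d0).
by apply: filterS => u; exact: xd.
Qed.

Lemma compact_halfline_itv (T : R) : compact [set s : H | - T <= val s].
Proof.
(* The absolute value covers a negative [T], for which the set is empty. *)
have -> : [set s : H | - T <= val s] = (@hl R) @` [set` `[- `|T|, 0]%R] `&` [set
  s : H | - T <= val s].
  apply/seteqP; split => [s sT/=|s []//]; split => //.
  exists (val s); last by rewrite hlK.
  rewrite /= in_itv/= halfline_le0 andbT (le_trans _ sT)// lerN2.
  exact: ler_norm.
apply: compact_closedI.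
  apply: continuous_compact; last exact: segment_compact.
  by apply: continuous_subspaceT; exact: continuous_hl.
rewrite (_ : [set _ | _] = val @^-1` [set t | - T <= t])//.
by apply: closed_comp; [move=> s _;
  exact: continuous_val_halfline|exact: closed_ge].
Qed.

Lemma compact_halfline_bounded (K : set H) : compact K ->
  exists n : nat, forall s, K s -> - n%:R <= val s.
Proof.
move=> cK.
have : compact (val @` K).
  apply: continuous_compact => //.
  by apply: continuous_subspaceT; exact: continuous_val_halfline.
move=> /compact_bounded[M [_ KM]].
exists (Num.truncn (`|M| + 1)).+1 => s Ks.
have := KM (`|M| + 1); rewrite (le_lt_trans (ler_norm M)) ?ltrDl// =>
  /(_ erefl (val s)).
move=> /(_ (ex_intro2 _ _ s Ks erefl)) /=; rewrite ler_norml => /andP[+ _].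
apply: le_trans; rewrite lerN2 ltW//; exact: Num.Theory.truncnS_gt.
Qed.

(** Witnesses against tightness at [e], scaled into the unit ball and vanishing on longer and longer
    intervals, converge to 0 in the compact-open topology because compact subsets of the half-line
    are bounded; yet their images stay above [e] in norm. *)
Lemma D2_tight (L : BU -> V) : D1 L -> D2 L -> tight L.
Proof.
move=> L1 L2 e e0; apply: contrapT => /forall2NP noT.
have /choice[h hP] : forall n : nat, exists x : BU,
    [/\ zero_after n%:R x, `|x| <= 1 & e < `|L x|].
  move=> n; have [/(_ (ler0n R n))//|/existsNP[x /not_implyP[vx /negP]]] := noT
    n%:R.
  rewrite -ltNge => eLx.
  have x0 : 0 < `|x|.
    rewrite normr_gt0; apply/eqP => x0; move: eLx.
    by rewrite x0 D1_0// !normr0 mulr0 ltxx.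
  exists (`|x|^-1 *: x); split.
  - by move=> s sn; rewrite -[LHS]/(_ *: x s) (vx _ sn) scaler0.
  - by rewrite normrZ normfV normr_id mulVf ?gt_eqF.
  - by rewrite D1Z// normrZ normfV normr_id mulrC ltr_pdivlMr.
have hcvg : (h n : bu_compact_open R m) @[n --> \oo] --> ((0 : BU) :
  bu_compact_open R m).
  move=> A [_ [[B oB <-] B0 BA]].
  have : nbhs (bu_fun (0 : BU) : {compact-open, H -> V}) B.
    exact: open_nbhs_nbhs.
  suff : (bu_fun (h n) : {compact-open, H ->
    V}) @[n --> \oo] --> (bu_fun (0 : BU) : {compact-open, H -> V}).
    move=> hc Bn; exact: (@filterS nat \oo _ _ _ (fun n => BA (h n)) (hc B Bn)).
  apply/compact_open_cvgP => K O cK oO KO.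
  have [N KN] := compact_halfline_bounded cK.
  exists N => // n /= Nn _ [s Ks <-].
  have [vh _ _] := hP n.
  rewrite vh; last first.
    by rewrite (le_trans _ (KN _ Ks))// lerN2 ler_nat.
  by apply: KO; exists s.
have /subspace_continuousP/(_ (0 : BU)) := L2 1 ltr01.
rewrite /= normr0 => /(_ ler01)/cvgrPdist_lt/(_ _ e0) L0.
have /hcvg[N _ NE] : nbhs ((0 : BU) : bu_compact_open R m)
    [set x : BU | `|x| <= 1 -> `|L 0 - L x| < e] by [].
have [_ h1 hL] := hP N.
have := NE N (leqnn N) h1; rewrite D1_0// sub0r normrN => /(lt_trans hL).
by rewrite ltxx.
Qed.

(** Split [y] into its cut-off, controlled by the boundedness of [L], and the rest, which lives in
    the remote past and is controlled by tightness. *)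
Lemma tight_uniform (L : BU -> V) (B e : R) : D1 L -> tight L -> 0 < B ->
  0 < e ->
  exists T eta, [/\ 0 <= T, 0 < eta & forall y : BU, `|y| <= B ->
    (forall s, - T <= val s -> `|y s| < eta) -> `|L y| < e].
Proof.
move=> L1 Lt B0 e0.
have [M M0 LM] := D1_bound L1.
(* [B *+ 2] bounds the norm of [y - bu_cut T y]. *)
have e1 : 0 < e / 2 / (B *+ 2) by rewrite !divr_gt0// mulrn_wgt0.
have [T T0 LT] := Lt _ e1.
have e2 : 0 < e / 2 / M / 2 by rewrite !divr_gt0.
exists (T + 1), (e / 2 / M / 2); split=> [|//|y yB ye]; first exact: addr_ge0.
rewrite -[y](subrK (bu_cut T y)) D1D//.
rewrite (le_lt_trans (ler_normD _ _))// [ltRHS]splitr.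
apply: ler_ltD; last first.
  apply: le_lt_trans (LM _) _; rewrite -ltr_pdivlMl// mulrC.
  apply: (@le_lt_trans _ _ (e / 2 / M / 2)); last first.
    by rewrite ltr_pdivrMr// ltr_pMr ?divr_gt0// ltr1n.
  apply: bu_le => s.
  have [Ks|Ks] := leP (- (T + 1)) (val s); last first.
    rewrite /= cutoff0 ?scale0r ?normr0 ?(ltW e2)//.
    by have := ltW Ks; rewrite opprD.
  rewrite /= normrZ ger0_norm ?cutoff_ge0//.
  apply: (@le_trans _ _ `|y s|); first by rewrite ler_piMl ?cutoff_le1.
  exact/ltW/ye.
apply: le_trans (LT _ _) _.
  move=> s sT; rewrite -[LHS]/(y s - _ *: _) cutoff1// scale1r.
  exact: subrr.
rewrite -ler_pdivlMl// mulrC invf_div mulrCA divff ?gt_eqF ?divr_gt0// mulr1.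
by rewrite (le_trans (ler_normB _ _))// mulr2n lerD//
  (le_trans (bu_cut_le _ _)).
Qed.

(** By linearity, continuity at [x] on the ball of radius r concerns differences, which lie in the
    ball of radius 2 r; and uniform closeness on the compact interval [-T, 0] defines a compact-open
    neighbourhood. *)
Lemma tight_D2 (L : BU -> V) : D1 L -> tight L -> D2 L.
Proof.
move=> L1 Lt r r0; apply/subspace_continuousP => x xr.
apply/cvgrPdist_lt => e e0.
have [T [eta [T0 eta0 LT]]] := tight_uniform L1 Lt (mulrn_wgt0 2 r0) e0.
pose K := [set s : H | - T <= val s].
have /(@initial_continuous _ _ (@bu_fun R m : BU -> {compact-open, H -> V}) x) :
    nbhs (bu_fun x : {compact-open, H -> V})
      [set y | forall s, K s -> ball (x s) eta (y s)].
  have := @compact_open_fam_compactP H V x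
    (nbhs (bu_fun x : {compact-open, H -> V})) (@continuous_bu x) _.
  move=> [/(_ (fun _ => id)) + _]; apply.
  apply: (@fam_nbhs H V compact K [set p | ball p.1 eta p.2]).
    exact: (@entourage_ball _ V (PosNum eta0)).
  exact: compact_halfline_itv.
move=> nx; rewrite near_withinE.
apply: (@filterS _ _ (nbhs_filter (x : bu_compact_open R m)) _ _ _ nx).
move=> y xy yr; rewrite -D1B//; apply: LT.
  by rewrite (le_trans (ler_normB _ _))// mulr2n lerD.
move=> s sT; have := xy s sT; rewrite -ball_normE; exact.
Qed.

End compact_open_tight.

(** * Solving on bounded intervals *)

Section solving.
Variables (R : realType) (m : nat).
Local Notation H := (halfline R).
Local Notation V := 'cV[R]_m.
Local Notation BU := (BU R m).
Implicit Types (x y z g w : BU) (s t : H).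

Lemma zero_before_shift T x s : zero_before T x -> zero_before T (bu_shift x s).
Proof.
move=> xT t tT; apply: xT; apply: le_trans tT => /=.
by rewrite gerDr halfline_le0.
Qed.

Lemma zero_beforeD T x y : zero_before T x -> zero_before T y ->
  zero_before T (x + y).
Proof.
by move=> xT yT s sT; rewrite -[LHS]/(x s + y s) xT// yT// addr0.
Qed.

Lemma zero_beforeB T x y : zero_before T x -> zero_before T y ->
  zero_before T (x - y).
Proof.
by move=> xT yT s sT; rewrite -[LHS]/(x s - y s) xT// yT// subr0.
Qed.

Lemma zero_before_le T U x : T <= U -> zero_before T x -> zero_before U x.
Proof. by move=> TU xT s sU; apply: xT; rewrite (le_trans sU)// lerN2. Qed.

Lemma zero_before_cut T x : zero_before (T + 1) (bu_cut T x).
Proof. by move=> s sT; rewrite /= cutoff0 ?scale0r// -opprD. Qed.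

Lemma cvg_div_expr2 (C : R) : C / 2 ^+ n @[n --> \oo] --> 0.
Proof.
have h : `|2^-1 : R| < 1 by rewrite ger0_norm ?invr_ge0// invf_lt1// ltr1n.
have := @cvg_geometric R C _ h;
  rewrite (_ : geometric _ _ = fun n => C / 2 ^+ n)//.
by apply/funext => n; rewrite /geometric /= exprVn.
Qed.

Lemma le_div_expr2_0 (V' : normedModType R) (a : V') (C : R) :
  (forall n, `|a| <= C / 2 ^+ n) -> a = 0.
Proof.
move=> aC; apply/eqP; rewrite -normr_le0 leNgt; apply/negP => a0.
have /cvgrPdist_lt/(_ _ a0)[N _ NE] := cvg_div_expr2 C.
have := NE N (leqnn N); rewrite sub0r normrN => /(le_lt_trans (ler_norm _)).
by rewrite ltNge aC.
Qed.

(** For d >= 0, [x] is moved to the left by [d] and the gap [-d, 0] is filled with the constant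
    x(0), which preserves continuity. *)
Definition advance (d : R) x : BU := bu_comp x (lip1_shift d).

Lemma advance_shift d x s : val s <= - d ->
  bu_shift (advance d x) s = bu_shift x (hl (val s + d)).
Proof.
move=> sd; apply: bu_ext => u; rewrite !bu_shiftE.
rewrite -[LHS]/(x (hl (val (halfline_add s u) + d))); congr (x _);
  apply/val_inj.
have u0 := halfline_le0 u.
by rewrite val_hl !val_add !val_hl !min_l; lra.
Qed.

Section atomic.
Variables (D : BU -> V) (hD : D1 D) (d : R) (d0 : 0 < d).
Hypothesis Dd : forall x, zero_before d x ->
  `|D x - x (halfline0 R)| <= 2^-1 * `|x|.

Let N x := x - hat hD x.

Let NzeroB x : zero_before d x -> zero_before d (N x).
Proof.
move=> xd s sd; rewrite -[LHS]/(x s - hat hD x s) xd// sub0r hatE.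
rewrite (_ : bu_shift x s = 0) ?D1_0 ?oppr0//.
apply: bu_ext => u; apply: xd; apply: le_trans sd.
by rewrite gerDl halfline_le0.
Qed.

Let N_le x : zero_before d x -> `|N x| <= 2^-1 * `|x|.
Proof.
move=> xd; apply: bu_le => s.
rewrite -[N x s]/(x s - D (bu_shift x s)) distrC.
have := Dd (zero_before_shift s xd);
  rewrite bu_shiftE halfline_add0 => /le_trans; apply.
by rewrite ler_wpM2l ?invr_ge0// bu_shift_le.
Qed.

Let NB x y : N x - N y = N (x - y).
Proof. by rewrite /N hatB !opprB [hat hD y - y]addrC addrACA [- hat hD x +
  _]addrC. Qed.

(* The Neumann series of D^ = 1 - N. *)
Lemma solve_small g : zero_before d g ->
  exists z, [/\ zero_before d z, hat hD z = g & `|z| <= 2 * `|g|].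
Proof.
move=> gd; pose u n := iter n (fun x => g + N x) 0.
have ud n : zero_before d (u n).
  by elim: n => [s _//|n IH]; exact: zero_beforeD gd (NzeroB IH).
have uE n : u n.+1 = g + N (u n) by [].
(* The iterates lie in the ball of radius 2 |g|, which x |-> g + N x preserves since |N x| <= |x| /
   2; each further step halves the distances. *)
have ue n k : `|u (n + k)%N - u n| <= 2 * `|g| / 2 ^+ n.
  elim: n k => [|n IH] k.
    rewrite subr0 expr0 divr1; elim: k => [|k];
      first by rewrite normr0 mulr_ge0.
    rewrite !add0n uE => IH; rewrite (le_trans (ler_normD _ _))//.
    rewrite mulr_natl mulr2n lerD2l (le_trans (N_le (ud _)))//.
    by rewrite ler_pdivrMl.
  rewrite addSn !uE opprD addrACA subrr add0r NB.
  rewrite (le_trans (N_le (zero_beforeB (ud _) (ud _))))// exprS invfM mulrCA.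
  by rewrite ler_wpM2l ?invr_ge0.
have [z ze] := bu_lim (cvg_div_expr2 (2 * `|g|)) ue.
have zd : zero_before d z.
  move=> s sd; apply: (@le_div_expr2_0 _ _ (2 * `|g|)) => n.
  apply: le_trans (ze n); rewrite -[X in `|X|]subr0 -(ud n s sd).
  exact: (bu_ge (z - u n)).
exists z; split=> //; last by have := ze 0%N; rewrite subr0 expr0 divr1.
apply/eqP; rewrite -subr_eq0; apply/eqP.
apply: (@le_div_expr2_0 _ _ (2 * `|g|)) => n.
(* The residual of [z] is a difference of two iteration errors, each at most |g| / 2 ^ n. *)
have -> : hat hD z - g = (z - u n.+1) - N (z - u n).
  rewrite -NB uE [- (N z - _)]opprB opprD; move: (N (u n)) => a.
  rewrite !addrA subrK -[N z]/(z - hat hD z) opprB.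
  by rewrite [RHS]addrC addrA subrK.
rewrite (le_trans (ler_normB _ _))// [leRHS]splitr lerD//.
  by rewrite (le_trans (ze _))// exprS invfM mulrCA [leRHS]mulrC.
rewrite (le_trans (N_le (zero_beforeB zd (ud n))))// [leRHS]mulrC.
by rewrite ler_wpM2l ?invr_ge0.
Qed.

(** Method of steps: the part of [g] before -d is solved by induction after a shift and moved back
    by [advance]; what remains of the right-hand side lives in [-d, 0]. The constant grows with [n],
    and only stability will give a uniform one. *)
Lemma solve_zero_before (n : nat) : exists2 K, 0 <= K &
  forall g, zero_before (n%:R * d) g ->
    exists2 z, hat hD z = g & `|z| <= K * `|g|.
Proof.
have [M M0 DM] := D1_bound hD.
have hatM x : `|hat hD x| <= M * `|x|.
  apply: bu_le => s; rewrite hatE (le_trans (DM _))//.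
  by rewrite ler_wpM2l ?bu_shift_le ?ltW.
elim: n => [|n [K K0 IH]].
  exists 0 => // g g0; exists 0; last by rewrite normr0 mul0r.
  apply: bu_ext => s; rewrite (g0 s) ?mul0r ?oppr0 ?halfline_le0//.
  rewrite hatE (_ : bu_shift 0 s = 0) ?D1_0//; exact: bu_ext.
exists (K + 2 * (1 + M * K)).
  by rewrite addr_ge0// mulr_ge0// addr_ge0// mulr_ge0// ltW.
move=> g gd; pose a := hl (- d); have va : val a = - d.
  by rewrite val_hl_le0// oppr_le0 ltW.
have [z' z'g z'K] : exists2 z, hat hD z = bu_shift g a & `|z| <= K * `|g|.
  have [|z zg zK] := IH (bu_shift g a).
    move=> s sd; apply: gd; rewrite val_add va.
    by rewrite -[n.+1]addn1 natrD mulrDl mul1r; lra.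
  by exists z => //; rewrite (le_trans zK)// ler_wpM2l// bu_shift_le.
pose x := advance d z'.
have xK : `|x| <= K * `|g| by exact: le_trans (bu_comp_le _ _) z'K.
have xg : zero_before d (g - hat hD x).
  move=> s sd; rewrite -[LHS]/(g s - hat hD x s) hatE advance_shift//.
  rewrite -hatE z'g bu_shiftE; apply/eqP; rewrite subr_eq0; apply/eqP.
  congr (g _); apply/val_inj; rewrite val_add va val_hl min_l; lra.
have [z [_ zg zK]] := solve_small xg.
exists (x + z); first by rewrite hatD zg addrC subrK.
rewrite (le_trans (ler_normD _ _))// mulrDl lerD//.
rewrite (le_trans zK)// -mulrA ler_wpM2l//.
rewrite (le_trans (ler_normB _ _))// mulrDl mul1r lerD2l.
by rewrite (le_trans (hatM x))// -mulrA ler_wpM2l// ltW.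
Qed.

Lemma extend_homogeneous w : D w = 0 -> exists w',
  bu_shift w' (hl (- d)) = w /\ forall s, - d <= val s -> hat hD w' s = 0.
Proof.
move=> Dw; pose x := advance d w.
(* The residual of [x] is frozen before -d at its value there. This value is D w = 0, so the
   truncation is still continuous and is supported in [-d, 0]. *)
pose g := - bu_comp (hat hD x) (lip1_max (- d)).
have vd : val (hl (- d)) = - d by rewrite val_hl_le0// oppr_le0 ltW.
have xw : bu_shift x (hl (- d)) = w.
  by rewrite advance_shift vd// addNr hl0 bu_shift0.
have gd : zero_before d g.
  move=> s sd; rewrite -[LHS]/(- hat hD x (hl (Num.max (- d) (val s)))).
  by rewrite max_l// hatE xw Dw oppr0.
have [z [zd zg _]] := solve_small gd.
exists (x + z); split.
  rewrite bu_shiftD xw (_ : bu_shift z _ = 0) ?addr0//.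
  apply: bu_ext => s; apply: zd; rewrite val_add vd.
  by rewrite gerDl halfline_le0.
move=> s sd; rewrite hatD zg -[LHS]/(hat hD x s - hat hD x (hl (Num.max (- d)
  (val s)))).
by rewrite max_r// hlK subrr.
Qed.

End atomic.
End solving.

(** * Consequences of stability *)

Lemma halfline_split (R : realType) (d : R) (s : halfline R) :
  0 <= d -> val s <= - d -> s = halfline_add (hl (- d)) (hl (val s + d)).
Proof.
move=> d0 sd; apply/val_inj; rewrite val_add !val_hl !min_l; lra.
Qed.

Section stable_estimates.
Variables (R : realType) (m : nat).
Local Notation H := (halfline R).
Local Notation V := 'cV[R]_m.
Local Notation BU := (BU R m).
Implicit Types (x y z g w : BU) (s : H).

Variables (D : BU -> V) (hD : D1 D) (d : R) (d0 : 0 < d).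
Hypothesis Dd : forall x, zero_before d x ->
  `|D x - x (halfline0 R)| <= 2^-1 * `|x|.

(** Repeated prolongation by pieces of length [d] yields a solution on the whole line, the kind to
    which [stable] applies; the clock is reset so that -T becomes time 0. *)
Lemma extend_solution T w : 0 <= T ->
  (forall s, - T <= val s -> hat hD w s = 0) ->
  exists2 x, is_solution D (bu_shift w (hl (- T))) x & x T = w (halfline0 R).
Proof.
move=> T0 wT; have vT : val (hl (- T)) = - T by rewrite val_hl_le0// oppr_le0.
have vd (n : nat) : val (hl (- (n%:R * d))) = - (n%:R * d).
  by rewrite val_hl_le0// oppr_le0 mulr_ge0// ltW.
(* [W n] is the solution up to time [T + n d], shifted to end at time 0. *)
have /choice[e eP] w' : exists w'', D w' = 0 ->
    bu_shift w'' (hl (- d)) = w' /\ forall s, - d <= val s -> hat hD w'' s = 0.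
  (* The 0 is a default, never reached: every [W n] is annihilated by [D]. *)
  have [w'0|w'0] := pselect (D w' = 0); last by exists 0.
  by have [w'' ?] := extend_homogeneous hD d0 Dd w'0; exists w''.
pose W n := iter n e w.
have DW n : D (W n) = 0.
  elim: n => [|n IH]; first by rewrite -(hat_0 hD) wT//= oppr_le0.
  have [_ h] := eP _ IH; rewrite -(hat_0 hD); apply: h.
  by rewrite oppr_le0 ltW.
have WS n : bu_shift (W n.+1) (hl (- d)) = W n by have [] := eP _ (DW n).
have Wshift k n : bu_shift (W (n + k)%N) (hl (- (k%:R * d))) = W n.
  elim: k => [|k IH]; first by rewrite mul0r oppr0 hl0 addn0 bu_shift0.
  rewrite -[in RHS]IH -(WS (n + k)%N) bu_shift_shift addnS; congr bu_shift.
  apply/val_inj; rewrite val_add !vd val_hl_le0 ?oppr_le0 ?(ltW d0)//.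
  by rewrite -[k.+1]addn1 natrD mulrDl mul1r; lra.
have hatW n s : - (n%:R * d + T) <= val s -> hat hD (W n) s = 0.
  elim: n s => [|n IH] s sn; first by apply: wT; rewrite mul0r add0r in sn.
  have [h1 h2] := eP _ (DW n).
  have [sd|sd] := leP (- d) (val s); first exact: h2.
  have -> : s = halfline_add (hl (- d)) (hl (val s + d)).
    exact: halfline_split (ltW d0) (ltW sd).
  rewrite -[LHS]/(bu_shift (hat hD (W n.+1)) (hl (- d)) (hl (val s + d))).
  rewrite -hat_shift WS; apply: IH; rewrite val_hl_le0; last by lra.
  by move: sn; rewrite -[n.+1]addn1 natrD mulrDl mul1r; lra.
have N (t : R) : exists n : nat, t - T <= n%:R * d.
  exists (Num.truncn `|(t - T) / d|).+1.
  rewrite -ler_pdivrMr// (le_trans (ler_norm _))// ltW//.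
  exact: Num.Theory.truncnS_gt.
have [k kP] := choice N.
(* [k t] is some rank that reaches time [t]; by [xE] the value does not depend on this choice. *)
pose x t := W (k t) (hl (t - T - (k t)%:R * d)).
have xE t n : t - T <= n%:R * d -> x t = W n (hl (t - T - n%:R * d)).
  have aux a b u : (a <= b)%N -> u <= a%:R * d ->
      W a (hl (u - a%:R * d)) = W b (hl (u - b%:R * d)).
    move=> ab ua; rewrite -(subnKC ab) -{1}(Wshift (b - a)%N a) bu_shiftE.
    congr (W _ _); apply/val_inj; rewrite val_add vd.
    have ba : 0 <= (b - a)%N%:R * d by rewrite mulr_ge0// ltW.
    by rewrite natrD mulrDl !val_hl !min_l; lra.
  rewrite /x => tn; have [nk|kn] := leP n (k t).
    by rewrite (aux _ _ _ nk tn).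
  by rewrite (aux _ _ _ (ltnW kn) (kP t)).
exists x; last by rewrite (xE T 0%N) subrr ?mul0r// subr0 hl0.
split.
- move=> t.
  (* One rank serves all times up to t + 1, so that [x] coincides with [F] near [t]. *)
  pose n := k (t + 1).
  have tn : t + 1 - T <= n%:R * d := kP _.
  pose F u := W n (hl (u - T - n%:R * d)).
  have Ft : F u @[u --> t] --> F t.
    apply: (@continuous_comp _ _ _ (fun u => hl (u - T - n%:R * d)) (W n));
      last exact: continuous_bu.
    apply: (@continuous_comp _ _ _ (fun u => u - T - n%:R * d) (@hl R));
      last exact: continuous_hl.
    by do 2 (apply: cvgB; last exact: cvg_cst); exact: cvg_id.
  rewrite /continuous_at (xE t n); last by lra.
  apply: cvg_trans Ft; apply: near_eq_cvg; near=> u; rewrite /F -xE//.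
  suff : u <= t + 1 by lra.
  by near: u; apply: (@cvgr_le _ _ _ _ _ t); [exact: cvg_id|rewrite ltrDl].
- apply/funext => s; rewrite /history add0r (xE _ 0%N) mul0r; last first.
    by have := halfline_le0 s; lra.
  rewrite subr0 [RHS]bu_shiftE; congr (w _); apply/val_inj.
  by have s0 := halfline_le0 s; rewrite val_add vT val_hl min_l; lra.
- move=> t t0; have tn := kP t.
  exists (bu_shift (W (k t)) (hl (t - T - (k t)%:R * d))).
    apply/funext => s; rewrite /history (xE _ (k t)); last first.
      by have := halfline_le0 s; lra.
    rewrite bu_shiftE; congr (W _ _); apply/val_inj.
    by have s0 := halfline_le0 s; rewrite val_add !val_hl !min_l; lra.
  by rewrite -(hatE hD) hatW// val_hl_le0; lra.
Unshelve. all: by end_near. Qed.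

Variable (c : R -> R).
Hypotheses (c0 : c t @[t --> +oo] --> 0).
Hypothesis c_stable : forall phi, D phi = 0 -> forall x : R ->
  V, is_solution D phi x ->
  forall t, 0 <= t -> `|x t| <= c t * `|phi|.

Lemma homogeneous_le T w : 0 <= T -> 0 <= c T ->
  (forall s, - T <= val s -> hat hD w s = 0) ->
  `|w (halfline0 R)| <= c T * `|w|.
Proof.
move=> T0 cT0 wT; have [x xs <-] := extend_solution T0 wT.
have vT : val (hl (- T)) = - T by rewrite val_hl_le0// oppr_le0.
apply: le_trans (c_stable _ xs T0) _; first by rewrite -(hatE hD) wT// vT.
by rewrite ler_wpM2l// bu_shift_le.
Qed.

Lemma hat_solve T g : zero_before T g -> exists z, hat hD z = g.
Proof.
move=> gT; pose n := (Num.truncn `|T / d|).+1.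
have [K _ /(_ g)[|z zg _]] := solve_zero_before hD d0 Dd n; last by exists z.
apply: zero_before_le gT; rewrite -ler_pdivrMr// (le_trans (ler_norm _))//
  ltW//.
exact: Num.Theory.truncnS_gt.
Qed.

Lemma hat_bounded_below : (forall t, 0 <= t -> 0 <= c t) ->
  exists2 K, 0 < K & forall z, `|z| <= K * `|hat hD z|.
Proof.
move=> c_ge0.
have [T T0 cT] : exists2 T, 0 <= T & c T <= 2^-1.
  have h : \forall t \near +oo, c t <= 2^-1.
    by apply: (@cvgr_le _ _ _ _ _ 0) => //; rewrite invr_gt0.
  near (pinfty_nbhs R) => T; exists T; first by near: T; exact: nbhs_pinfty_ge.
  by near: T.
pose n := (Num.truncn `|(T + 1) / d|).+1.
have Tn : T + 1 <= n%:R * d.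
  rewrite -ler_pdivrMr// (le_trans (ler_norm _))// ltW//.
  exact: Num.Theory.truncnS_gt.
have [K K0 KP] := solve_zero_before hD d0 Dd n.
(* As c T <= 1/2, each value of [z] is at most (|z| + K |D^ z|) / 2 + K |D^ z|. Absorbing |z| / 2 on
   the left gives 3 K; the 1 makes the constant positive. *)
exists (3 * K + 1); first by rewrite ltr_wpDl// mulr_ge0.
move=> z.
suff zs s : `|z s| <= 2^-1 * `|z| + 3/2 * (K * `|hat hD z|).
  have := bu_le zs; have := normr_ge0 (hat hD z);
    rewrite [(3 * K + 1) * _](_ : _ = 3 * (K * `|hat hD z|) + `|hat hD z|);
      last by ring.
  by move: (K * _) => a; lra.
pose g := hat hD (bu_shift z s).
have gz : `|g| <= `|hat hD z| by rewrite /g hat_shift bu_shift_le.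
have [v vg vK] := KP _ (zero_before_le Tn (@zero_before_cut _ _ T g)).
have {}vK : `|v| <= K * `|hat hD z|.
  by rewrite (le_trans vK)// ler_wpM2l// (le_trans (bu_cut_le _ _)).
have -> : z s = (bu_shift z s - v) (halfline0 R) + v (halfline0 R).
  by rewrite -[X in _ = X + _]/(bu_shift z s (halfline0 R) - v _) subrK
    bu_shiftE halfline_add0.
rewrite (le_trans (ler_normD _ _))//.
have h : `|(bu_shift z s - v) (halfline0 R)| <= c T * `|bu_shift z s - v|.
  apply: homogeneous_le => //; first exact: c_ge0.
  move=> t tT; rewrite hatB vg -/g -[LHS]/(g t - cutoff T t *: g t).
  by rewrite cutoff1// scale1r subrr.
have h' : c T * `|bu_shift z s - v| <= 2^-1 * (`|z| + `|v|).
  rewrite ler_pM ?c_ge0// (le_trans (ler_normB _ _))// lerD2r.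
  exact: bu_shift_le.
have := bu_ge v (halfline0 R).
by move: h h' vK; move: (K * _) => a; lra.
Unshelve. all: by end_near. Qed.

End stable_estimates.

(** * The dual operator *)

Section dual.
Variables (R : realType) (m : nat).
Local Notation H := (halfline R).
Local Notation V := 'cV[R]_m.
Local Notation BU := (BU R m).
Implicit Types (x y z g w : BU) (s : H).

Lemma bu_cut_linear (T a : R) x y :
  bu_cut T (a *: x + y) = a *: bu_cut T x + bu_cut T y.
Proof. by rewrite bu_cutD bu_cutZ. Qed.

Lemma le_cvg0 (a C : R) (e : nat -> R) : e n @[n --> \oo] --> 0 ->
  (forall n, a <= e n * C) -> a <= 0.
Proof.
move=> e0 ae.
have eC : e n * C @[n --> \oo] --> 0.
  by rewrite -[X in _ --> X](mul0r C); apply: cvgM => //; exact: cvg_cst.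
rewrite -(cvg_lim (@Rhausdorff R) eC).
by apply: limr_ge; [apply/cvg_ex; exists 0|exact: nearW].
Qed.

Section dual_functional.
Variables (D : BU -> V) (hD : D1 D) (tD : tight D) (K : R) (K0 : 0 < K).
Hypothesis hatK : forall z, `|z| <= K * `|hat hD z|.
Hypothesis hat_surj : forall T g, zero_before T g -> exists z, hat hD z = g.
Variable c : nat -> R.
Hypotheses (c_ge0 : forall n, 0 <= c n) (c0 : c n @[n --> \oo] --> 0).
Hypothesis hom : forall n w, (forall s, - n%:R <= val s -> hat hD w s = 0) ->
  `|w (halfline0 R)| <= c n * `|w|.

Lemma hat_inj : injective (hat hD).
Proof.
move=> x y xy; apply/eqP; rewrite -subr_eq0 -normr_le0.
by rewrite (le_trans (hatK _))// hatB xy subrr normr0 mulr0.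
Qed.

Lemma dual_functional : exists L (hL : D1 L), tight L /\
  cancel (hat hL) (hat hD).
Proof.
have /choice[E hE] (p : nat * BU) : exists z, hat hD z = bu_cut p.1%:R p.2.
  exact: hat_surj (@zero_before_cut _ _ _ _).
have EK n g : `|E (n, g)| <= K * `|g|.
  by rewrite (le_trans (hatK _))// hE ler_wpM2l ?(ltW K0)// bu_cut_le.
have cC C : (c n * C) @[n --> \oo] --> 0.
  by rewrite -[X in _ --> X](mul0r C); apply: cvgM => //; exact: cvg_cst.
(* The images under D^ of [E (n + k, g)] and [E (n, g)] agree on [-n, 0], so by [hom] their values
   at 0 differ by at most c n times the norm of the difference, itself at most 2 K |g|. *)
have /choice[L LE] g : exists l, forall n,
    `|l - E (n, g) (halfline0 R)| <= c n * (2 * K * `|g|).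
  apply: (cauchy_rate_lim (cC _)) => n k.
  have := @hom n (E ((n + k)%N, g) - E (n, g)) => /(_ _)/le_trans; apply.
    move=> s sn; rewrite hatB !hE /=.
    rewrite -[LHS]/(_ *: _ - _ *: _) !cutoff1 ?subrr//=.
    by rewrite (le_trans _ sn)// lerN2 ler_nat leq_addr.
  rewrite ler_wpM2l// (le_trans (ler_normB _ _))// -mulrA mulr_natl mulr2n.
  by rewrite lerD.
have LK g : `|L g| <= (1 + c 0%N * 2) * K * `|g|.
  rewrite -[L g](subrK (E (0%N, g) (halfline0 R))) (le_trans (ler_normD _ _))//.
  have := LE g 0%N; have := EK 0%N g; have := bu_ge (E (0%N, g)) (halfline0 R).
  rewrite (_ : (1 + _) * _ * _ = c 0%N * (2 * K * `|g|) + K * `|g|);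
    last by ring.
  move: (K * `|g|) (c 0%N * _) => a b; lra.
have linL : linear L.
  move=> a g h; apply/eqP; rewrite -subr_eq0 -normr_le0.
  apply: (@le_cvg0 _ (2 * K * `|a *: g + h| + `|a| * (2 * K * `|g|) + 2 * K *
    `|h|) c) => // n.
  have En : E (n, a *: g + h) = a *: E (n, g) + E (n, h).
    by apply: hat_inj; rewrite hatD hatZ !hE/= bu_cut_linear.
  have En0 : E (n, a *: g + h) (halfline0 R) =
      a *: E (n, g) (halfline0 R) + E (n, h) (halfline0 R) by rewrite En.
  have := LE (a *: g + h) n; rewrite En0.
  move=> h1; have h2 := LE g n; have h3 := LE h n.
  rewrite (_ : _ - _ = (L (a *: g + h) - (a *: E (n, g) (halfline0 R) + E (n, h)
    (halfline0 R)))
    - a *: (L g - E (n, g) (halfline0 R)) - (L h - E (n, h) (halfline0 R)));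
      last first.
    by apply/matrixP => i j; rewrite !mxE; ring.
  rewrite (le_trans (ler_normB _ _))// 2!mulrDr lerD//.
  rewrite (le_trans (ler_normB _ _))// lerD//.
  by rewrite normrZ mulrCA ler_wpM2l.
have hL : D1 L := bounded_D1 linL LK.
have tL : tight L.
  move=> e e0.
  (* If [g] vanishes on [-n, 0], then [E (n, g)] is homogeneous there and its value at 0 costs K;
     the distance from [L g] to that value costs 2 K. *)
  have [n cn] : exists n, c n * (3 * K) <= e.
    have /cvgrPdist_lt/(_ _ e0)[N _ NE] := cC (3 * K).
    exists N; have := NE N (leqnn N); rewrite sub0r normrN => /ltW.
    by apply: le_trans; exact: ler_norm.
  exists n%:R => // g vg.
  apply: (@le_trans _ _ (c n * (3 * K) * `|g|)); last by rewrite ler_wpM2r.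
  have h1 := LE g n.
  have h2 : `|E (n, g) (halfline0 R)| <= c n * (K * `|g|).
    apply: le_trans (@hom n _ _) _; last by rewrite ler_wpM2l.
    by move=> s sn; rewrite hE -[LHS]/(_ *: g s) vg// scaler0.
  rewrite -[L g](subrK (E (n, g) (halfline0 R))) (le_trans (ler_normD _ _))//.
  rewrite (_ : c n * _ * _ = c n * (2 * K * `|g|) + c n * (K * `|g|));
    last by ring.
  exact: lerD.
exists L, hL; split=> // g.
suff DE h : D (hat hL h) = h (halfline0 R).
  by apply: bu_ext => s; rewrite hatE -hat_shift DE bu_shiftE halfline_add0.
apply/eqP; rewrite -subr_eq0 -normr_le0; apply/ler_addgt0Pl => e e0.
rewrite addr0.
(* A bound, independent of n, on the norm of [hat hL h - E (n, h)], to which the tightness of [D] is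
   applied. *)
have B0 : 0 < (1 + c 0%N * 2) * K * `|h| + K * `|h| + 1.
  by rewrite ltr_wpDl// addr_ge0// !mulr_ge0// ?(ltW K0)// addr_ge0// mulr_ge0.
have [T [eta [T0 eta0 DT]]] := tight_uniform hD tD B0 e0.
(* The factor 4 is 2 + 2: once for stopping the limit that defines [L] at rank k, once for
   exchanging shift and cut-off. *)
have [k ck] : exists k, c k * (4 * K * `|h|) < eta.
  have /cvgrPdist_lt/(_ _ eta0)[N _ NE] := cC (4 * K * `|h|).
  exists N; have := NE N (leqnn N); rewrite sub0r normrN.
  by apply: le_lt_trans; exact: ler_norm.
(* For s >= -T and u >= -k, the cut-off of rank k at u and that of rank n at s + u are then both
   1. *)
have [n Tn] : exists n : nat, k%:R + T <= n%:R.
  exists (k + (Num.truncn T).+1)%N; rewrite natrD lerD2l ltW//.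
  exact: Num.Theory.truncnS_gt.
have -> : h (halfline0 R) = D (E (n, h)).
  by rewrite -(hat_0 hD) hE /= cutoff1 ?scale1r//= oppr_le0.
rewrite -D1B// ltW//; apply: DT.
  rewrite (le_trans (ler_normB _ _))// -addrA lerD//; last first.
    by rewrite (le_trans (EK _ _))// lerDl.
  apply: bu_le => s; rewrite hatE (le_trans (LK _))// ler_wpM2l ?bu_shift_le//.
  by rewrite mulr_ge0 ?(ltW K0)// addr_ge0// mulr_ge0.
move=> s sT; apply: le_lt_trans ck.
rewrite -[X in `|X|]/(L (bu_shift h s) - E (n, h) s).
have h1 := LE (bu_shift h s) k.
pose w := E (k, bu_shift h s) - bu_shift (E (n, h)) s.
have wE : w (halfline0 R) = E (k, bu_shift h s) (halfline0 R) - E (n, h) s.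
  by rewrite -[LHS]/(_ - E (n, h) (halfline_add s _)) halfline_add0.
have h2 : `|w (halfline0 R)| <= c k * (2 * K * `|h|).
  apply: le_trans (@hom k _ _) _.
    move=> u uk; rewrite hatB hat_shift !hE/=.
    rewrite -[LHS]/(cutoff k%:R u *: h (halfline_add s u) -
      cutoff n%:R (halfline_add s u) *: h (halfline_add s u)).
    rewrite !cutoff1 ?subrr// val_add; lra.
  rewrite ler_wpM2l// (le_trans (ler_normB _ _))// -mulrA mulr_natl mulr2n.
  rewrite lerD// ?(le_trans (EK _ _))// ?ler_wpM2l ?(ltW K0)// ?bu_shift_le//.
  by rewrite (le_trans (bu_shift_le _ _)).
have -> : L (bu_shift h s) - E (n, h) s =
    (L (bu_shift h s) - E (k, bu_shift h s) (halfline0 R)) + w (halfline0 R).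
  by rewrite wE addrA subrK.
rewrite (le_trans (ler_normD _ _))//.
rewrite (_ : c k * (4 * _ * _) = c k * (2 * K * `|h|) + c k * (2 * K * `|h|));
  last by ring.
rewrite lerD// (le_trans h1)// ler_wpM2l// ler_wpM2l ?bu_shift_le//.
by rewrite mulr_ge0// ltW.
Qed.

End dual_functional.
End dual.

(** * Stability of the dual operator *)

Section dual_stable.
Variables (R : realType) (m : nat).
Local Notation H := (halfline R).
Local Notation V := 'cV[R]_m.
Local Notation BU := (BU R m).
Implicit Types (x y z g w : BU) (s : H).

Lemma zero_after_le (T U : R) x : T <= U -> zero_after U x -> zero_after T x.
Proof. by move=> TU xU s sT; apply: xU; rewrite (le_trans _ sT)// lerN2. Qed.

(* [c] is the smallest 1-Lipschitz majorant of the modulus of tightness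
   T |-> sup {|D y| : |y| <= 1, y = 0 on [-T, 0]}. *)
Lemma tight_modulus (D : BU -> V) : D1 D -> tight D -> exists c : R -> R,
  [/\ continuous c, forall t, 0 <= t -> 0 <= c t, c t @[t --> +oo] --> 0 &
    forall t y, 0 <= t -> zero_after t y -> `|D y| <= c t * `|y|].
Proof.
move=> hD tD; have [M M0 DM] := D1_bound hD.
pose S t := [set r : R | exists y T, [/\ 0 <= T, `|y| <= 1, zero_after T y &
  r = `|D y| - `|t - T|]].
pose c t := sup (S t).
have DM1 y : `|y| <= 1 -> `|D y| <= M.
  by move=> y1; rewrite (le_trans (DM y))// ler_piMr// ltW.
have Sub t r : S t r -> r <= M.
  move=> [y [T [_ y1 _ ->]]]; rewrite (le_trans _ (DM1 _ y1))//.
  by rewrite lerBlDr lerDl.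
have S0 t : S t !=set0.
  exists (`|D 0| - `|t - 0|), 0, 0; split => //; first by rewrite normr0.
have Sc t r : S t r -> r <= c t.
  by move=> Sr; apply: ub_le_sup => //; exists M => ?; exact: Sub.
have cS t a : (forall r, S t r -> r <= a) -> c t <= a by move=> ?;
  exact: ge_sup.
have cge0 t : 0 <= t -> 0 <= c t.
  move=> t0; apply: Sc; exists 0, t; split => //; first by rewrite normr0.
  by rewrite subrr D1_0// !normr0 subrr.
have clip t u : c t <= c u + `|t - u|.
  apply: cS => _ [y [T [T0 y1 vy ->]]].
  rewrite -lerBlDr; apply: (@le_trans _ _ (`|D y| - `|u - T|)).
    by have := ler_distD t u T; rewrite (distrC u t); lra.
  by apply: Sc; exists y, T.
exists c; split => //.
- move=> t; apply/cvgrPdist_lt => e e0; near=> u.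
  apply: (@le_lt_trans _ _ `|t - u|).
    rewrite ler_norml; have := clip t u; have := clip u t; rewrite (distrC u).
    by move=> *; lra.
  by near: u; exact: (@cvgr_dist_lt _ R^o).
- apply/cvgrPdist_le => e e0.
  have [T T0 DT] := tD _ e0.
  near=> t; rewrite sub0r normrN ger0_norm; last first.
    by apply: cge0; near: t; exact: nbhs_pinfty_ge.
  apply: cS => _ [y [U [U0 y1 vy ->]]].
  (* If [y] vanishes on all of [-T, 0], tightness applies. Otherwise U < T, and once t >= T + M the
     penalty |t - U| outweighs the bound M on |D y|. *)
  have [TU|UT] := leP T U.
    rewrite (le_trans _ (le_trans (DT y _) _)) //.
    + by rewrite lerBlDr lerDl.
    + exact: zero_after_le vy.
    + by rewrite ler_piMr// ltW.
  have Dy := DM1 _ y1; have tTM : T + M <= t.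
    by near: t; apply: nbhs_pinfty_ge; exact: num_real.
  by have := ler_norm (t - U); lra.
- move=> t y t0 vy.
  have [->|y0] := eqVneq y 0; first by rewrite D1_0// !normr0 mulr0.
  have ny0 : 0 < `|y| by rewrite normr_gt0.
  rewrite -ler_pdivrMr// mulrC -[X in X * _]ger0_norm ?invr_ge0//
    -normrZ -D1Z//.
  apply: Sc; exists (`|y|^-1 *: y), t; split => //.
  + by rewrite normrZ normfV normr_id mulVf// gt_eqF.
  + by move=> s st; rewrite -[LHS]/(_ *: y s) vy// scaler0.
  + by rewrite subrr normr0 subr0.
Unshelve. all: by end_near. Qed.

Lemma dual_stable (D L : BU -> V) (hD : D1 D) (hL : D1 L) :
  tight D -> cancel (hat hL) (hat hD) -> stable L.
Proof.
move=> tD LD; have [c [cc c_ge0 c0 cD]] := tight_modulus hD tD.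
have [K K0 LK] := D1_bound hL.
exists (fun t => K * c t); split.
- apply: continuous_subspaceT => t.
  by apply: cvgM; [exact: cvg_cst|exact: cc].
- by move=> t t0; rewrite mulr_ge0 ?c_ge0// ltW.
- by rewrite -[X in _ --> X](mulr0 K); apply: cvgM => //; exact: cvg_cst.
move=> phi _ x [_ x0 xL] t t0.
have [xt xtE _] := xL t t0.
have xts s : xt s = x (t + val s) by rewrite xtE.
have -> : x t = xt (halfline0 R) by rewrite xts/= addr0.
rewrite -(LD xt) hat_0 mulrAC.
(* On [-t, 0] this function vanishes, and before -t it is computed from [phi] alone; hence a bound
   in which t does not occur. *)
have yphi : `|hat hL xt| <= K * `|phi|.
  apply: bu_le => s; rewrite hatE.
  have [ts|ts] := leP 0 (t + val s).
    have [y yE Ly] := xL _ ts.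
    rewrite (_ : bu_shift xt s = y) ?Ly ?normr0 ?mulr_ge0 ?(ltW K0)//.
    apply: bu_ext => u; rewrite bu_shiftE xts yE /history.
    by rewrite val_add addrA.
  rewrite (_ : bu_shift xt s = bu_shift phi (hl (t + val s))).
    rewrite (le_trans (LK _))// ler_wpM2l ?(ltW K0)// bu_shift_le//.
  apply: bu_ext => u; rewrite !bu_shiftE xts -x0 /history add0r.
  by rewrite !val_add val_hl_le0 ?(ltW ts)// addrA.
rewrite mulrAC (le_trans (cD t _ t0 _))//.
  move=> s st; rewrite hatE.
  have ts : 0 <= t + val s by lra.
  have [y yE Ly] := xL _ ts.
  rewrite (_ : bu_shift xt s = y)//.
  apply: bu_ext => u; rewrite bu_shiftE xts yE /history.
  by rewrite val_add addrA.
by rewrite mulrC -mulrA [c t * _]mulrC mulrA ler_wpM2r ?c_ge0.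
Qed.

End dual_stable.

(** * Riesz representation *)

Section scalar_bu.
Variable R : realType.
Local Notation H := (halfline R).
Implicit Types (f g : H -> R) (s t : H).

(** The scalar counterpart of [is_bu], kept as a predicate on bare functions so that functionals
    apply directly to products, minima and ramps. *)
Definition sbu f :=
  (exists M, forall s, `|f s| <= M) /\
  forall e, 0 < e -> exists2 d, 0 < d &
    forall s t, `|val s - val t| < d -> `|f s - f t| < e.

Lemma sbu_bound f : sbu f -> exists2 M, 0 < M & forall s, `|f s| <= M.
Proof.
move=> [[M fM] _]; exists (`|M| + 1); first by rewrite ltr_wpDl.
by move=> s; rewrite (le_trans (fM s))// (le_trans (ler_norm _))// lerDl.
Qed.

Lemma sbu_lip f M k : 0 < k -> (forall s, `|f s| <= M) ->
  (forall s t, `|f s - f t| <= k * `|val s - val t|) -> sbu f.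
Proof.
move=> k0 fM fk; split; first by exists M.
move=> e e0; exists (e / k); first by rewrite divr_gt0.
move=> s t; rewrite ltr_pdivlMr// mulrC; exact/le_lt_trans.
Qed.

Lemma sbu_cst a : sbu (fun=> a).
Proof.
apply: (@sbu_lip _ `|a| 1) => // s t.
by rewrite subrr normr0 mul1r.
Qed.

Lemma sbuD f g : sbu f -> sbu g -> sbu (fun s => f s + g s).
Proof.
move=> [[M fM] fu] [[N gN] gu]; split.
  by exists (M + N) => s; rewrite (le_trans (ler_normD _ _))// lerD.
move=> e e0; have e2 : 0 < e / 2 by rewrite divr_gt0.
have [d d0 fd] := fu _ e2; have [d' d'0 gd'] := gu _ e2.
exists (Num.min d d'); first by rewrite lt_min d0.
move=> s t; rewrite lt_min => /andP[/fd sd /gd' sd'].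
rewrite opprD addrACA (le_lt_trans (ler_normD _ _))// [ltRHS]splitr.
exact: ltrD.
Qed.

Lemma sbuM f g : sbu f -> sbu g -> sbu (fun s => f s * g s).
Proof.
move=> sf sg; have [M M0 fM] := sbu_bound sf; have [N N0 gN] := sbu_bound sg.
have [[_ fu] [_ gu]] := (sf, sg).
split.
  by exists (M * N) => s; rewrite normrM ler_pM.
move=> e e0.
have [d d0 fd] := fu (e / 2 / N) (divr_gt0 (divr_gt0 e0 (ltr0Sn _ 1)) N0).
have [d' d'0 gd'] := gu (e / 2 / M) (divr_gt0 (divr_gt0 e0 (ltr0Sn _ 1)) M0).
exists (Num.min d d'); first by rewrite lt_min d0.
move=> s t; rewrite lt_min => /andP[/fd sd /gd' sd'].
rewrite (_ : _ - _ = f s * (g s - g t) + g t * (f s - f t)); last by ring.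
rewrite (le_lt_trans (ler_normD _ _))// [ltRHS]splitr !normrM ltrD//.
  move: sd'; rewrite ltr_pdivlMr// mulrC; apply: le_lt_trans.
  by rewrite ler_wpM2r.
move: sd; rewrite ltr_pdivlMr// mulrC; apply: le_lt_trans.
by rewrite ler_wpM2r.
Qed.

Lemma sbuZ a f : sbu f -> sbu (fun s => a * f s).
Proof. by move=> sf; apply: (@sbuM (fun=> a)) => //; exact: sbu_cst. Qed.

Lemma sbuB f g : sbu f -> sbu g -> sbu (fun s => f s - g s).
Proof.
move=> sf sg; apply: sbuD => //.
rewrite (_ : (fun s => - g s) = (fun s => -1 * g s)); first exact: sbuZ.
by apply/funext => s; rewrite mulN1r.
Qed.

Lemma min_lip2 (a b c d e : R) : `|a - c| < e -> `|b - d| < e ->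
  `|Num.min a b - Num.min c d| < e.
Proof.
rewrite !ltr_norml => /andP[? ?] /andP[? ?]; apply/andP.
by rewrite /Num.min; case: (ltP a b) => ?; case: (ltP c d) => ?; split; lra.
Qed.

Lemma sbu_min f g : sbu f -> sbu g -> sbu (fun s => Num.min (f s) (g s)).
Proof.
move=> sf sg; have [M M0 fM] := sbu_bound sf; have [N N0 gN] := sbu_bound sg.
have [[_ fu] [_ gu]] := (sf, sg).
split.
  exists (M + N) => s; rewrite /Num.min; case: (ltP (f s) (g s)) => _.
    by rewrite (le_trans (fM s))// lerDl ltW.
  by rewrite (le_trans (gN s))// lerDr ltW.
move=> e e0; have [d d0 fd] := fu _ e0; have [d' d'0 gd'] := gu _ e0.
exists (Num.min d d'); first by rewrite lt_min d0.
move=> s t; rewrite lt_min => /andP[/fd sd /gd' sd'].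
exact: min_lip2.
Qed.

Lemma continuous_sbu f : sbu f -> continuous f.
Proof.
move=> [_ fu] s; apply/(@cvgrPdist_lt R R H (nbhs s) (nbhs_filter s)) =>
  e /fu[d d0 fd].
have vs : val u @[u --> s] --> val s by exact: continuous_val_halfline.
have := vs; move/(@cvgrPdist_lt R R H (nbhs s) (nbhs_filter s)) => /(_ _ d0).
by apply: filterS => u; exact: fd.
Qed.

(** The laws are restricted to nonnegative functions because [pos_part], the main instance, is a
    supremum that is meaningful only for these. *)
Record pos_functional (F : (H -> R) -> R) : Prop := PosFunctional {
  pfD : forall f g, sbu f -> sbu g -> (forall s, 0 <= f s) ->
    (forall s, 0 <= g s) -> F (fun s => f s + g s) = F f + F g ;
  pfZ : forall a f, 0 <= a -> sbu f -> (forall s, 0 <= f s) ->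
    F (fun s => a * f s) = a * F f ;
  pf_ge0 : forall f, sbu f -> (forall s, 0 <= f s) -> 0 <= F f ;
  pf_tight : forall e, 0 < e -> exists2 T, 0 <= T & forall f, sbu f ->
    (forall s, 0 <= f s <= 1) -> (forall s, - T <= val s -> f s = 0) ->
      F f <= e }.

Record tight_functional (F : (H -> R) -> R) : Prop := TightFunctional {
  tfD : forall f g, sbu f -> sbu g -> F (fun s => f s + g s) = F f + F g ;
  tfZ : forall a f, sbu f -> F (fun s => a * f s) = a * F f ;
  tf_bound : exists2 M, 0 < M & forall f C, sbu f -> (forall s, `|f s| <= C) ->
    `|F f| <= M * C ;
  tf_tight : forall e, 0 < e -> exists2 T, 0 <= T & forall f, sbu f ->
    (forall s, `|f s| <= 1) -> (forall s, - T <= val s -> f s = 0) ->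
      `|F f| <= e }.

(** * Jordan decomposition of a tight functional *)

Section jordan.
Variables (F : (H -> R) -> R) (hF : tight_functional F).

Let S f := [set F g | g in [set g | sbu g /\ forall s, 0 <= g s <= f s]].

(** The Riesz-Kantorovich formula for the positive part of a functional. *)
Definition pos_part f := sup (S f).

Let Sbound f : sbu f -> has_ubound (S f).
Proof.
move=> sf; have [M M0 FM] := tf_bound hF; have [C C0 fC] := sbu_bound sf.
exists (M * C) => _ [g [sg gf] <-]; apply: le_trans (ler_norm _) _.
apply: FM => // s; have /andP[g0 gs] := gf s.
by rewrite ger0_norm// (le_trans gs)// (le_trans (ler_norm _)).
Qed.

Let F0 : F (fun=> 0) = 0.
Proof.
have -> : (fun=> 0 : R) = (fun s : H => 0 * 1 : R).
  by apply/funext => s; rewrite mul0r.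
by rewrite (tfZ hF)//; [rewrite mul0r|exact: sbu_cst].
Qed.

Let S0 f : (forall s, 0 <= f s) -> S f 0.
Proof.
move=> f0; exists (fun=> 0) => //; split; first exact: sbu_cst.
by move=> s; rewrite lexx f0.
Qed.

Let pos_part_ge f g : sbu f -> sbu g -> (forall s, 0 <= g s <= f s) ->
  F g <= pos_part f.
Proof. by move=> sf sg gf; apply: ub_le_sup; [exact: Sbound|exists g]. Qed.

Let pos_part_le f a : (forall s, 0 <= f s) ->
  (forall g, sbu g -> (forall s, 0 <= g s <= f s) -> F g <= a) ->
  pos_part f <= a.
Proof.
move=> f0 fa; apply: ge_sup; first by exists 0; exact: S0.
by move=> _ [g [sg gf] <-]; exact: fa.
Qed.

Let FB f g : sbu f -> sbu g -> F (fun s => f s - g s) = F f - F g.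
Proof.
move=> sf sg.
rewrite (_ : (fun s => f s - g s) = (fun s => f s + -1 * g s)).
  by rewrite (tfD hF)//; [rewrite (tfZ hF)// mulN1r|exact: sbuZ].
by apply/funext => s; rewrite mulN1r.
Qed.

Let pos_partD f g : sbu f -> sbu g -> (forall s, 0 <= f s) ->
  (forall s, 0 <= g s) -> pos_part (fun s =>
    f s + g s) = pos_part f + pos_part g.
Proof.
move=> sf sg f0 g0; have sfg := sbuD sf sg; apply/eqP; rewrite eq_le;
  apply/andP; split.
  apply: pos_part_le => [s|h sh hfg]; first exact: addr_ge0.
  (* Riesz decomposition: a function between 0 and f + g is the sum of its minimum with [f] and of a
     remainder between 0 and [g]. *)
  pose h1 s := Num.min (h s) (f s).
  have sh1 : sbu h1 by exact: sbu_min.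
  have -> : F h = F h1 + F (fun s => h s - h1 s) by rewrite FB// addrC subrK.
  apply: lerD; apply: pos_part_ge => //; [|exact: sbuB|].
    move=> s; have := hfg s; have := f0 s; rewrite /h1 /Num.min.
    by case: (ltP (h s) (f s)) => ? ? /andP[? ?]; apply/andP; split; lra.
  move=> s; have := hfg s; have := f0 s; have := g0 s; rewrite /h1 /Num.min.
  by case: (ltP (h s) (f s)) => ? ? ? /andP[? ?]; apply/andP; split; lra.
rewrite -lerBrDr; apply: pos_part_le => // h sh hf.
rewrite lerBrDr addrC -lerBrDr; apply: pos_part_le => // k sk kg.
rewrite lerBrDr addrC -(tfD hF)//; apply: pos_part_ge => //; first exact: sbuD.
move=> s; have /andP[? ?] := hf s; have /andP[? ?] := kg s.
by apply/andP; split; lra.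
Qed.

Let pos_partZ a f : 0 <= a -> sbu f -> (forall s, 0 <= f s) ->
  pos_part (fun s => a * f s) = a * pos_part f.
Proof.
have le b g : 0 < b -> sbu g -> (forall s, 0 <= g s) ->
    pos_part (fun s => b * g s) <= b * pos_part g.
  move=> b0 sg g0; apply: pos_part_le => [s|h sh hg].
    by rewrite mulr_ge0// ltW.
  rewrite -ler_pdivrMl// -(tfZ hF)//; apply: pos_part_ge => //;
    first exact: sbuZ.
  move=> s; have /andP[h0 hgs] := hg s.
  by rewrite mulr_ge0 ?invr_ge0 ?(ltW b0)//= ler_pdivrMl.
rewrite le_eqVlt => /orP[/eqP <-|a0] sf f0.
  rewrite mul0r; apply/eqP; rewrite eq_le; apply/andP; split.
    apply: pos_part_le => [s|g sg g0]; first by rewrite mul0r.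
    rewrite (_ : g = fun=> 0) ?F0//; apply/funext => s.
    by apply/eqP; rewrite eq_le andbC; have := g0 s; rewrite mul0r.
  rewrite -[leLHS]F0; apply: pos_part_ge; [exact: sbuZ|exact: sbu_cst|].
  by move=> s; rewrite mul0r lexx.
apply/eqP; rewrite eq_le le//= -ler_pdivlMl//.
(* The reverse inequality is [le] for the inverse factor. *)
have := @le a^-1 (fun s => a * f s); rewrite invr_gt0 => /(_ a0 (sbuZ _ sf)).
rewrite (_ : (fun s => _) = f); last first.
  by apply/funext => s; rewrite mulrA mulVf ?gt_eqF// mul1r.
by apply => s; rewrite mulr_ge0// ltW.
Qed.

Lemma pos_functional_pos_part : pos_functional pos_part.
Proof.
split.
- exact: pos_partD.
- exact: pos_partZ.
- move=> f sf f0; rewrite -F0; apply: pos_part_ge => //; first exact: sbu_cst.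
  by move=> s; rewrite lexx f0.
- move=> e /(tf_tight hF)[T T0 FT]; exists T => // f sf f1 fT.
  apply: pos_part_le => [s|g sg gf]; first by case/andP: (f1 s).
  rewrite (le_trans (ler_norm _))//; apply: FT => // s.
    have /andP[g0 gfs] := gf s; have /andP[_ fs1] := f1 s.
    by rewrite ger0_norm// (le_trans gfs).
  move=> sT; have := gf s; rewrite fT// => /andP[? ?].
  by apply/eqP; rewrite eq_le; apply/andP.
Qed.

Lemma pos_functional_neg_part : pos_functional (fun f => pos_part f - F f).
Proof.
split.
- by move=> f g sf sg f0 g0; rewrite pos_partD// (tfD hF)//; ring.
- by move=> a f a0 sf f0; rewrite pos_partZ// (tfZ hF)// mulrBr.
- move=> f sf f0; rewrite subr_ge0; apply: pos_part_ge => // s.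
  by rewrite f0 lexx.
- move=> e e0; have e2 : 0 < e / 2 by rewrite divr_gt0.
  have [T T0 FT] := tf_tight hF e2.
  have [U U0 FU] := pf_tight pos_functional_pos_part e2.
  exists (Num.max T U); first by rewrite le_max T0.
  move=> f sf f1 fTU.
  have f1' s : `|f s| <= 1 by rewrite ger0_norm; case/andP: (f1 s).
  have fT s : - T <= val s -> f s = 0.
    by move=> sT; apply: fTU; rewrite (le_trans _ sT)// lerN2 le_max lexx.
  have fU s : - U <= val s -> f s = 0.
    by move=> sU; apply: fTU; rewrite (le_trans _ sU)// lerN2 le_max lexx orbT.
  have := FU _ sf f1 fU; have := FT _ sf f1' fT; rewrite ler_norml => /andP[].
  lra.
Qed.

End jordan.
End scalar_bu.

(** * Distribution function of a positive functional *)

Section ramps.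
Variable R : realType.
Local Notation H := (halfline R).
Implicit Types (f g : H -> R) (s : H).

(** For k > 0, a uniformly continuous majorant of the indicator of (-oo, t]: it falls from 1 at [t]
    to 0 at t + 1/k and decreases as k grows. *)
Definition ramp (k t : R) s : R := Num.max 0 (Num.min 1 (1 + k * (t - val s))).

Lemma ramp_ge0 k t s : 0 <= ramp k t s.
Proof. by rewrite le_max lexx. Qed.

Lemma ramp_le1 k t s : ramp k t s <= 1.
Proof. by rewrite ge_max ler01 ge_min lexx. Qed.

Lemma sbu_ramp k t : 0 < k -> sbu (ramp k t).
Proof.
move=> k0; apply: (@sbu_lip _ _ 1 k) => // [s|s u].
  by rewrite ger0_norm ?ramp_ge0 ?ramp_le1.
rewrite (le_trans (maxr_lip _ _ _))// (le_trans (minr_lip _ _ _))//.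
rewrite (_ : _ - _ = k * - (val s - val u)); last by ring.
by rewrite normrM normrN gtr0_norm.
Qed.

Lemma ramp1 k t s : 0 < k -> val s <= t -> ramp k t s = 1.
Proof.
move=> k0 st; have h : 0 <= k * (t - val s) by rewrite mulr_ge0 ?subr_ge0 ?(ltW
  k0).
by rewrite /ramp min_l ?lerDl// max_r.
Qed.

Lemma ramp0 k t s : 0 < k -> t + k^-1 <= val s -> ramp k t s = 0.
Proof.
move=> k0 st; rewrite /ramp max_l// ge_min; apply/orP; right.
have : k * k^-1 <= k * (val s - t) by rewrite ler_pM2l//; lra.
by rewrite divff ?gt_eqF//; lra.
Qed.

Lemma clamp_homo (a b : R) : a <= b ->
  Num.max 0 (Num.min 1 a) <= Num.max 0 (Num.min 1 b).
Proof.
move=> ab; rewrite /Num.min; case: (ltP 1 a) => ?; case: (ltP 1 b) => ?;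
  rewrite /Num.max; repeat (case: ifPn; rewrite -?leNgt => ?); lra.
Qed.

Lemma ramp_homo k t u s : 0 < k -> t <= u -> ramp k t s <= ramp k u s.
Proof.
by move=> k0 tu; apply: clamp_homo; rewrite lerD2l ler_pM2l// lerD2r.
Qed.

Lemma ramp_anti k l t s : 0 < k -> k <= l -> ramp l t s <= ramp k t s.
Proof.
move=> k0 kl; have l0 := lt_le_trans k0 kl.
have [st|ts] := leP (val s) t; first by rewrite !ramp1.
by apply: clamp_homo; rewrite lerD2l ler_wnM2r// subr_le0 ltW.
Qed.

Lemma ramp_shift k t u s : 0 < k -> t <= u ->
  ramp k u s <= ramp k t s + k * (u - t).
Proof.
move=> k0 tu; rewrite -lerBlDl (le_trans (ler_norm _))//.
rewrite (le_trans (maxr_lip _ _ _))// (le_trans (minr_lip _ _ _))//.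
rewrite (_ : _ - _ = k * (u - t)); last by ring.
by rewrite ger0_norm// mulr_ge0 ?subr_ge0 ?(ltW k0).
Qed.

End ramps.

Section distribution_function.
Variable R : realType.
Local Notation H := (halfline R).
Implicit Types (f g : H -> R) (s : H).
Variables (L : (H -> R) -> R) (hL : pos_functional L).

Lemma pf_le f g : sbu f -> sbu g -> (forall s, 0 <= f s) ->
  (forall s, f s <= g s) -> L f <= L g.
Proof.
move=> sf sg f0 fg.
have -> : g = fun s => f s + (g s - f s) by apply/funext => s;
  rewrite addrC subrK.
have gf0 s : 0 <= g s - f s by rewrite subr_ge0.
rewrite (pfD hL)//; last exact: sbuB.
by rewrite lerDl; apply: (pf_ge0 hL) => //; exact: sbuB.
Qed.

(* For the measure representing [L], this is the integral of [f] over
   (-oo, t]; with [f = 1] it is the distribution function. *)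
Definition partial_mass f t : R :=
  inf [set L (fun s => f s * ramp k t s) | k in [set k | 0 < k]].

Local Notation A := partial_mass.
Let one : H -> R := fun=> 1.
Let sone : sbu one. Proof. exact: sbu_cst. Qed.
Let one0 s : 0 <= one s. Proof. exact: ler01. Qed.

Section fixed_f.
Variables (f : H -> R) (sf : sbu f) (f0 : forall s, 0 <= f s).

Let sfr k t : 0 < k -> sbu (fun s => f s * ramp k t s).
Proof. by move=> k0; apply: sbuM => //; exact: sbu_ramp. Qed.

Let fr0 k t s : 0 <= f s * ramp k t s.
Proof. by rewrite mulr_ge0 ?ramp_ge0. Qed.

Lemma partial_mass_le k t : 0 < k -> A f t <= L (fun s => f s * ramp k t s).
Proof.
move=> k0; apply: ge_inf; last by exists k.
by exists 0 => _ [l /= l0 <-]; apply: (pf_ge0 hL) => //; exact: sfr.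
Qed.

Lemma partial_mass_ge a t : (forall k, 0 < k -> a <= L (fun s =>
  f s * ramp k t s)) ->
  a <= A f t.
Proof.
move=> aL; apply: lb_le_inf; first by exists (L (fun s =>
  f s * ramp 1 t s)), 1 => /=.
by move=> _ [k /= k0 <-]; exact: aL.
Qed.

Lemma partial_mass_adherent e t : 0 < e -> exists2 k, 0 < k &
  forall l, k <= l -> L (fun s => f s * ramp l t s) <= A f t + e.
Proof.
move=> e0; have [|_ [k /= k0 <-] Lk] := @inf_adherent _
    [set L (fun s => f s * ramp k t s) | k in [set k | 0 < k]] _ e0.
  split; first by exists (L (fun s => f s * ramp 1 t s)), 1 => /=.
  by exists 0 => _ [l /= l0 <-]; apply: (pf_ge0 hL) => //; exact: sfr.
exists k => // l kl; have l0 := lt_le_trans k0 kl.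
apply: le_trans (ltW Lk); apply: pf_le; try exact: sfr; first exact: fr0.
by move=> s; rewrite ler_wpM2l// ramp_anti.
Qed.

Lemma partial_mass_homo t u : t <= u -> A f t <= A f u.
Proof.
move=> tu; apply: partial_mass_ge => k k0.
apply: le_trans (partial_mass_le t k0) _.
apply: pf_le; try exact: sfr; first exact: fr0.
by move=> s; rewrite ler_wpM2l// ramp_homo.
Qed.

Lemma partial_mass_top t : 0 <= t -> A f t = L f.
Proof.
move=> t0.
have Lf k : 0 < k -> L (fun s => f s * ramp k t s) = L f.
  move=> k0; congr L; apply/funext => s.
  by rewrite ramp1 ?mulr1// (le_trans (halfline_le0 s)).
apply/eqP; rewrite eq_le -{1}(Lf 1)// partial_mass_le//=.
by apply: partial_mass_ge => k /Lf ->.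
Qed.

End fixed_f.

Lemma partial_mass_step f t u eta q : sbu f -> (forall s, 0 <= f s) ->
  t <= u -> 0 < eta -> 0 <= q ->
  (forall s, t <= val s <= u + eta -> f s <= q) ->
  A f u <= A f t + q * (A one u - A one t).
Proof.
move=> sf f0 tu eta0 q0 fq; apply/ler_addgt0Pl => e e0.
have e2 : 0 < e / 2 by rewrite divr_gt0.
have q1 : 0 < q + 1 by rewrite ltr_wpDl.
have e3 : 0 < e / 2 / (q + 1) by rewrite divr_gt0.
have [k1 k10 hk1] := partial_mass_adherent sf f0 t e2.
have [k2 k20 hk2] := partial_mass_adherent sone one0 u e3.
(* Steep enough for both infima to be nearly attained and for the overshoot 1/k to stay within
   [eta]. *)
pose k := Num.max (Num.max k1 k2) eta^-1.
have k0 : 0 < k by rewrite !lt_max k10.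
have keta : k^-1 <= eta by rewrite -[leRHS]invrK lef_pV2 ?posrE ?invr_gt0//
  le_max lexx orbT.
have {}hk1 := hk1 k _; have {}hk2 := hk2 k _.
have {}hk1 : L (fun s => f s * ramp k t s) <= A f t + e / 2.
  by apply: hk1; rewrite !le_max lexx.
have {}hk2 : L (fun s => one s * ramp k u s) <= A one u + e / 2 / (q + 1).
  by apply: hk2; rewrite !le_max lexx orbT.
have hk3 := partial_mass_le sone one0 t k0.
have sr v : sbu (ramp k v) by exact: sbu_ramp.
have r0 s : 0 <= ramp k u s - ramp k t s by rewrite subr_ge0 ramp_homo.
apply: le_trans (partial_mass_le sf f0 u k0) _.
have -> : (fun s => f s * ramp k u s) =
    (fun s => f s * ramp k t s + f s * (ramp k u s - ramp k t s)).
  by apply/funext => s; ring.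
have sD : sbu (fun s => ramp k u s - ramp k t s) by exact: sbuB.
rewrite (pfD hL); [|exact: sbuM|exact: sbuM| |]; last 2 first.
- by move=> s; rewrite mulr_ge0 ?ramp_ge0.
- by move=> s; rewrite mulr_ge0.
have h1 : L (fun s => f s * (ramp k u s - ramp k t s)) <=
    L (fun s => q * (ramp k u s - ramp k t s)).
  apply: pf_le; [exact: sbuM|exact: sbuZ| |].
    by move=> s; rewrite mulr_ge0.
  move=> s; have [st|ts] := leP (val s) t.
    by rewrite !ramp1 ?subrr ?mulr0// (le_trans st).
  have [us|su] := leP (u + eta) (val s).
    have us' : u + k^-1 <= val s by rewrite (le_trans _ us)// lerD2l.
    by rewrite !ramp0 ?subrr ?mulr0// (le_trans _ us')// lerD2r.
  by rewrite ler_wpM2r// fq// !ltW.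
have h2 : L (fun s => one s * ramp k u s) = L (fun s => one s * ramp k t s) +
    L (fun s => ramp k u s - ramp k t s).
  rewrite -(pfD hL) //; [|exact: sbuM|by move=> s; rewrite mulr_ge0 ?ramp_ge0].
  by congr L; apply/funext => s; rewrite /one; ring.
move: h1; rewrite (pfZ hL)// => h1.
have h3 : q * L (fun s => ramp k u s - ramp k t s) <=
    q * (A one u - A one t) + e / 2.
  apply: (@le_trans _ _ (q * (A one u - A one t + e / 2 / (q + 1)))).
    by rewrite ler_wpM2l//; lra.
  rewrite mulrDr lerD2l mulrCA -[leRHS]mulr1 ler_wpM2l ?(ltW e2)//
    ler_pdivrMr//.
  by rewrite mul1r lerDl.
lra.
Qed.

(** [ramp k u] exceeds [ramp k t] by at most k (u - t) everywhere, so a slope nearly optimal at [t]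
    can be kept fixed while [u] decreases to [t]. *)
Lemma right_continuous_partial_mass t : A one u @[u --> t^'+] --> A one t.
Proof.
apply/cvgrPdist_le => e e0; have e2 : 0 < e / 2 by rewrite divr_gt0.
have [k k0 hk] := partial_mass_adherent sone one0 t e2.
have L1 : 0 < k * L one + 1.
  by rewrite ltr_wpDl// mulr_ge0 ?(pf_ge0 hL)// ltW.
near=> u.
have tu : t <= u by near: u; exact: nbhs_right_ge.
have ut : u - t <= e / 2 / (k * L one + 1).
  have : u <= t + e / 2 / (k * L one + 1).
    by near: u; apply: nbhs_right_le; rewrite ltrDl divr_gt0.
  lra.
rewrite distrC ger0_norm ?subr_ge0 ?partial_mass_homo//.
have h1 := partial_mass_le sone one0 u k0.
have h2 : L (fun s => one s * ramp k u s) <=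
    L (fun s => one s * ramp k t s) + k * (u - t) * L one.
  have kut : 0 <= k * (u - t) by rewrite mulr_ge0 ?subr_ge0 ?(ltW k0).
  have s1 v : sbu (fun s => one s * ramp k v s) by apply: sbuM => //;
    exact: sbu_ramp.
  have s2 : sbu (fun s => k * (u - t) * one s) by exact: sbuZ.
  have p1 v s : 0 <= one s * ramp k v s by rewrite mulr_ge0 ?ramp_ge0.
  have p2 s : 0 <= k * (u - t) * one s by rewrite mulr_ge0.
  rewrite -(pfZ hL)// -(pfD hL)//.
  apply: pf_le => //; first exact: sbuD.
  by move=> s; rewrite /one !mul1r mulr1 ramp_shift.
have h3 : k * (u - t) * L one <= e / 2.
  have : (u - t) * (k * L one + 1) <= e / 2 by rewrite -ler_pdivlMr.
  rewrite mulrDr mulr1 mulrA [k * _]mulrC; lra.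
have := hk k (lexx _); lra.
Unshelve. all: by end_near. Qed.

End distribution_function.

(** * Lebesgue-Stieltjes measures and pushforwards *)

Section stieltjes.
Variable R : realType.

Lemma lebesgue_stieltjes_itv (F : cumulative R R) (a b : R) : a <= b ->
  lebesgue_stieltjes_measure F `]a, b] = (F b - F a)%:E.
Proof.
move=> ab; rewrite /lebesgue_stieltjes_measure /measure_extension.
rewrite measurable_mu_extE/=; last exact: is_ocitv.
by rewrite wlength_itv_bnd.
Qed.

Lemma measurable_ocitvR (a b : R) : measurable (`]a, b] : set (measurableTypeR
  R)).
Proof. by apply: sub_sigma_algebra; exact: is_ocitv. Qed.

Lemma lebesgue_stieltjes_setT_le (F : cumulative R R) (M : R) :
  (forall a b, a <= b -> F b - F a <= M) ->
  (lebesgue_stieltjes_measure F setT <= M%:E)%E.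
Proof.
move=> FM; rewrite -(bigcup_itvT false false).
pose I n : set (measurableTypeR R) := `]- (n%:R), n%:R]%classic.
have : (lebesgue_stieltjes_measure F \o I) n @[n --> \oo] -->
    lebesgue_stieltjes_measure F (\bigcup_n I n).
  apply: nondecreasing_cvg_mu; rewrite /I//.
  - exact: bigcup_measurable.
  - by move=> *; apply/subsetPset/subset_itv; rewrite leBSide/= ?lerN2 ler_nat.
move=> FI; rewrite -(cvg_lim _ FI)//; apply: lime_le.
  by apply/cvg_ex; eexists; exact: FI.
apply: nearW => n; rewrite /= lebesgue_stieltjes_itv ?lee_fin ?FM//.
all: by rewrite (@le_trans _ _ 0)// oppr_le0.
Qed.

End stieltjes.

Lemma ex_finite_measure_pushforward d d' (X : measurableType d) (Y :
  measurableType d')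
    (R : realType) (phi : X -> Y) (mu : {measure set X -> \bar R}) :
  measurable_fun setT phi -> (mu setT < +oo)%E ->
  exists nu : {finite_measure set Y -> \bar R}, forall f : Y -> \bar R,
    measurable_fun setT f -> (forall y, 0 <= f y)%E ->
    (\int[nu]_y f y = \int[mu]_x f (phi x))%E.
Proof.
move=> mphi muT.
pose nu : {measure set Y -> \bar R} :=
  measure_function_pushforward__canonical__measure_function_Measure mu mphi.
have nuT : (nu setT < +oo)%E by rewrite /nu/= /pushforward preimage_setT.
exists (mfrestr measurableT nuT) => f mf f0.
rewrite (eq_measure_integral nu); last first.
  by move=> A mA _; exact: (congr1 nu (setIT A)).
rewrite ge0_integral_pushforward//.
Qed.

(** * Riesz theorem for positive tight functionals *)

Section riesz_positive.
Variable R : realType.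
Local Notation H := (halfline R).
Local Notation B := (g_sigma_algebraType (@open H)).
Implicit Types (f g : H -> R) (s : H).

Lemma measurable_hl : measurable_fun [set: measurableTypeR R] (@hl R : _ -> B).
Proof.
apply: (@measurability _ _ _ B _ _ (@open H)) => //.
move=> _ [U oU <-]; rewrite setTI; apply: open_measurable.
by have /continuousP := @continuous_hl R; apply.
Qed.

Lemma measurable_sbu f : sbu f -> measurable_fun [set: B] f.
Proof.
move=> sf; apply: (measurability _ (@RGenOpens.measurableE R)) => //.
move=> _ [_ [a [b ->]] <-]; rewrite setTI; apply: sub_sigma_algebra.
by have /continuousP := continuous_sbu sf; apply; exact: interval_open.
Qed.

Variables (L : (H -> R) -> R) (hL : pos_functional L).
Local Notation A := (partial_mass L).
Let one : H -> R := fun=> 1.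
Let sone : sbu one. Proof. exact: sbu_cst. Qed.
Let one0 s : 0 <= one s. Proof. exact: ler01. Qed.

Let F : cumulative R R := HB.pack (A one) (isCumulative.Build R _ R (A one)
  (partial_mass_homo hL sone one0) (right_continuous_partial_mass hL)).
Let mu := lebesgue_stieltjes_measure F.

Let mu_itv a b : a <= b -> mu `]a, b] = (A one b - A one a)%:E.
Proof. exact: lebesgue_stieltjes_itv. Qed.

Let muT : (mu setT <= (L one)%:E)%E.
Proof.
apply: lebesgue_stieltjes_setT_le => a b ab.
apply: (@le_trans _ _ (A one b)).
  rewrite lerBlDr lerDl; apply: partial_mass_ge => k k0.
  by apply: (pf_ge0 hL) => [|s]; [apply: sbuM => //;
    exact: sbu_ramp|rewrite mulr_ge0 ?ramp_ge0].
rewrite -(partial_mass_top hL sone one0 (normr_ge0 b)) partial_mass_homo//.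
exact: ler_norm.
Qed.

(** Tightness excludes mass at -oo. The ramp of slope 1 placed at -T - 1 vanishes from -T on, hence
    the shift by 1. *)
Let tail f e : sbu f -> (forall s, 0 <= f s) -> 0 < e ->
  exists2 T, 0 <= T & A f (- T) <= e.
Proof.
move=> sf f0 e0; have [C C0 fC] := sbu_bound sf.
have eC : 0 < e / C by rewrite divr_gt0.
have [T T0 LT] := pf_tight hL eC.
exists (T + 1); first exact: addr_ge0.
have s1 : sbu (ramp 1 (- (T + 1))) by exact: sbu_ramp.
apply: le_trans (partial_mass_le hL sf f0 _ ltr01) _.
apply: (@le_trans _ _ (L (fun s => C * ramp 1 (- (T + 1)) s))).
  apply: (pf_le hL).
  - exact: sbuM.
  - exact: sbuZ.
  - by move=> s; rewrite mulr_ge0 ?ramp_ge0.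
  - by move=> s; rewrite ler_wpM2r ?ramp_ge0// (le_trans (ler_norm _)).
rewrite (pfZ hL)//; [|exact: ltW|by move=> s; exact: ramp_ge0].
rewrite mulrC -ler_pdivlMr//; apply: LT => // s;
  first by rewrite ramp_ge0 ramp_le1.
by move=> sT; rewrite ramp0//; lra.
Qed.

Let measurable_hl_sbu f (D : set (measurableTypeR R)) : sbu f ->
  measurable_fun D (fun x : measurableTypeR R => f (hl x)).
Proof.
move=> sf; apply: measurable_funTS.
exact: (measurableT_comp (measurable_sbu sf) measurable_hl).
Qed.

Let functional_le_integral f : sbu f -> (forall s, 0 <= f s) ->
  ((L f)%:E <= \int[mu]_x (f (hl x))%:E)%E.
Proof.
move=> sf f0; apply/lee_addgt0Pr => e e0.
have L1 := pf_ge0 hL sone one0.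
have Lo : 0 < 2 + 2 * L one by rewrite ltr_pwDl// mulr_ge0.
(* [r] pays for the tail before -T, and the excess 2 r of [g] over [f] is integrated against a total
   mass of at most [L one]. *)
pose r := e / (2 + 2 * L one); have r0 : 0 < r by rewrite divr_gt0.
have [T T0 AT] := tail sf f0 r0.
have [d d0 fd] := sf.2 _ r0.
have d2 : 0 < d / 2 by rewrite divr_gt0.
pose t n : R := - T + n%:R * (d / 2).
pose g (x : measurableTypeR R) : \bar R := (f (hl x) + 2 * r)%:E.
have g0 x : (0 <= g x)%E by rewrite lee_fin addr_ge0// mulr_ge0// ltW.
have mg D : measurable_fun D g.
  by apply/measurable_EFinP/measurable_funD => //; exact: measurable_hl_sbu.
have tS n : t n <= t n.+1 by rewrite /t -[n.+1]addn1 natrD mulrDl mul1r; lra.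
have t0 n : t 0%N <= t n by elim: n => // n /le_trans; apply.
have step n : ((A f (t n.+1))%:E <= (A f (t n))%:E + \int[mu]_(x in `]t n, t
  n.+1]) g x)%E.
  (* The cell, enlarged by the overshoot d / 4, stays within [d] of its right end, so [f] varies
     there by less than [r]; the 2 r in [g] then makes [g] dominate [q] on the cell. *)
  pose q := f (hl (t n.+1)) + r.
  have q0 : 0 <= q by rewrite addr_ge0// ltW.
  have tSE : t n.+1 = t n + d / 2 by rewrite /t -[n.+1]addn1 natrD mulrDl mul1r
    addrA.
  have fq s : t n <= val s <= t n.+1 + d / 4 -> f s <= q.
    rewrite tSE => /andP[? ?].
    have : `|f s - f (hl (t n.+1))| < r.
      apply: fd; rewrite -{1}(hlK s) (le_lt_trans (hl_lip _ _))// tSE.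
      by rewrite ltr_norml; apply/andP; split; lra.
    by rewrite ltr_norml /q => /andP[_ ?]; lra.
  have d4 : 0 < d / 4 by rewrite divr_gt0.
  have := partial_mass_step hL sf f0 (tS n) d4 q0 fq.
  rewrite -lee_fin => /le_trans; apply; rewrite EFinD leeD2l//.
  rewrite EFinM -(mu_itv (tS n)) -integral_cst//.
  apply: ge0_le_integral => //.
  move=> x /=; rewrite in_itv/= => /andP[? ?]; rewrite lee_fin /q.
  have : `|f (hl (t n.+1)) - f (hl x)| < r.
    apply: fd; rewrite (le_lt_trans (hl_lip _ _))//.
    by rewrite ltr_norml; apply/andP; split; lra.
  by rewrite ltr_norml => /andP[? ?]; lra.
have sum n : ((A f (t n))%:E <= (A f (t 0%N))%:E + \int[mu]_(x in `]t 0%N, t n])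
  g x)%E.
  elim: n => [|n IH]; first by rewrite leeDl// integral_ge0.
  apply: le_trans (step n) _.
  have -> : `]t 0%N, t n.+1]%classic = `]t 0%N, t n] `|` `]t n, t n.+1] :> set
    (measurableTypeR R).
    by rewrite -itv_bndbnd_setU// bnd_simp.
  rewrite ge0_integral_setU//.
  - by rewrite [leRHS]addeA; exact: (leeD IH (lexx _)).
  - apply/disj_setPS => x [] /=; rewrite !in_itv/= => /andP[_ xt] /andP[tx _].
    by move: (le_lt_trans xt tx); rewrite ltxx.
have [n n0] : exists n, 0 <= t n.
  exists (Num.truncn (T / (d / 2))).+1;
    rewrite /t addrC subr_ge0 -ler_pdivrMr// ltW//.
  exact: Num.Theory.truncnS_gt.
have := sum n; rewrite (partial_mass_top hL)// => /le_trans; apply.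
apply: (@le_trans _ _ (r%:E + \int[mu]_x g x)%E).
  apply: leeD; first by rewrite lee_fin /t mul0r addr0.
  by apply: ge0_subset_integral => //; exact: measurable_ocitvR.
rewrite /g (_ : (fun _ => _) = (fun x => (f (hl x))%:E + (2 * r)%:E)%E)//.
rewrite ge0_integralD//; last 3 first.
- by move=> x _; rewrite lee_fin.
- by apply/measurable_EFinP; exact: measurable_hl_sbu.
- by move=> x _; rewrite lee_fin mulr_ge0// ltW.
rewrite addeCA leeD2l// integral_cst//.
apply: (@le_trans _ _ (r%:E + (2 * r)%:E * (L one)%:E)%E).
  by rewrite leeD2l// lee_pmul// lee_fin mulr_ge0// ltW.
rewrite -EFinM -EFinD lee_fin.
have -> : e = r * (2 + 2 * L one) by rewrite /r divfK// gt_eqF.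
rewrite mulrDr; have := mulr_ge0 (ltW r0) L1; lra.
Qed.

Lemma riesz_positive : exists nu : {finite_measure set B -> \bar R},
  forall f, sbu f -> (forall s, 0 <= f s) -> (\int[nu]_s (f s)%:E = (L f)%:E)%E.
Proof.
have muTy : (mu setT < +oo)%E by rewrite (le_lt_trans muT)// ltey.
have [nu nuE] := ex_finite_measure_pushforward measurable_hl muTy.
have {}nuE f : sbu f -> (forall s, 0 <= f s) ->
    (\int[nu]_s (f s)%:E = \int[mu]_x (f (hl x))%:E)%E.
  move=> sf f0; apply: nuE => [|y]; last by rewrite lee_fin.
  by apply/measurable_EFinP; exact: measurable_sbu.
exists nu => f sf f0; rewrite nuE//; apply/eqP; rewrite eq_le; apply/andP;
  split; last first.
  exact: functional_le_integral.
(* The reverse inequality is the same one for [C - f]. *)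
have [C C0 fC] := sbu_bound sf.
have sC : sbu (fun s => C - f s) by apply: sbuB => //; exact: sbu_cst.
have Cf s : 0 <= C - f s by rewrite subr_ge0 (le_trans (ler_norm _)).
have := functional_le_integral sC Cf.
have LC : L (fun s => C - f s) + L f = C * L one.
  rewrite -(pfD hL)// -(pfZ hL)//; last exact: ltW.
  by congr L; apply/funext => s; rewrite subrK mulr1.
have IC : (\int[mu]_x (C - f (hl x))%:E + \int[mu]_x (f (hl x))%:E <= (C * L
  one)%:E)%E.
  rewrite -ge0_integralD//.
  - under eq_integral do rewrite -EFinD subrK.
    by rewrite integral_cst// EFinM lee_pmul2l// lte_fin.
  - by move=> x _; rewrite lee_fin.
  - by apply/measurable_EFinP; exact: (@measurable_hl_sbu _ _ sC).
  - by move=> x _; rewrite lee_fin.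
  - by apply/measurable_EFinP; exact: measurable_hl_sbu.
move=> h.
have : ((L (fun s => C - f s))%:E + \int[mu]_x (f (hl x))%:E <= (C * L
  one)%:E)%E.
  by apply: le_trans IC; rewrite leeD2r.
rewrite -LC EFinD leeD2lE//.
Qed.

End riesz_positive.

(** * Regularity of finite measures on the half-line *)

Section regularity.
Variable R : realType.
Local Notation H := (halfline R).
Local Notation B := (g_sigma_algebraType (@open H)).
Variable mu : {measure set B -> \bar R}.
Hypothesis muT : (mu setT < +oo)%E.

Let mu_lty A : measurable A -> (mu A < +oo)%E.
Proof.
by move=> mA; apply: le_lt_trans muT; apply: le_measure; rewrite ?inE.
Qed.

Lemma decreasing_lt (F : nat -> set B) (e : \bar R) :
  (forall n, measurable (F n)) -> {homo F : n k / (n <= k)%N >-> (k <= n)%O} ->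
  (mu (\bigcap_n F n) < e)%E -> exists n, (mu (F n) < e)%E.
Proof.
move=> mF dF Fe; apply: contrapT => /forallNP nF.
have : (mu \o F) n @[n --> \oo] --> mu (\bigcap_n F n).
  by apply: nonincreasing_cvg_mu => //;
    [exact: mu_lty|exact: bigcap_measurable].
move=> Fcvg; move: Fe; rewrite ltNge => /negP; apply.
rewrite -(cvg_lim _ Fcvg)//; apply: lime_ge.
  by apply/cvg_ex; eexists; exact: Fcvg.
by apply: nearW => n; rewrite leNgt; apply/negP; exact: nF.
Qed.

Lemma measurable_open (U : set H) : open U -> measurable (U : set B).
Proof. exact: sub_sigma_algebra. Qed.

Lemma measurable_closed (C : set H) : closed C -> measurable (C : set B).
Proof.
by move=> /closed_openC/measurable_open/measurableC; rewrite setCK.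
Qed.

Let approx (A : set B) := forall e : R, 0 < e -> exists C U : set H,
  [/\ closed C, open U, C `<=` A, A `<=` U & (mu (U `\` C : set B) < e%:E)%E].

Let approx_open (U : set H) : open U -> approx (U : set B).
Proof.
move=> oU e e0.
(* Shrinking neighbourhoods of the complement of [U] are removed, through interiors of balls so that
   what is removed is open; the closed sets left increase to [U]. *)
pose C n : set H := ~` \bigcup_(y in ~` U) (ball y n.+1%:R^-1)°.
have cC n : closed (C n).
  by apply: open_closedC; apply: bigcup_open => y _; exact: open_interior.
have CU n : C n `<=` U.
  move=> s; apply: contraPP => nUs; apply; exists s => //.
  exact: nbhsx_ballx.
have [n nC] : exists n, (mu (U `\` C n : set B) < e%:E)%E.
  apply: decreasing_lt.
  - move=> n; apply: measurableD;
    [exact: measurable_open|exact: measurable_closed].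
  - move=> n k nk; apply/subsetPset => s [Us nCs]; split => // Cs; apply: nCs.
    move=> [y nUy ys]; apply: Cs; exists y => //.
    by apply: interiorS ys; apply: le_ball; rewrite lef_pV2 ?posrE// ler_nat.
  - rewrite (_ : \bigcap_n _ = set0) ?measure0 ?lte_fin//.
    apply/seteqP; split => // s sI.
    have [Us _] := sI 0%N Logic.I.
    have : nbhs s U by exact: open_nbhs_nbhs.
    move=> /nbhs_ballP[d /= d0 dU].
    have [n nd] : exists n : nat, n.+1%:R^-1 < d.
      exists (Num.truncn d^-1); rewrite -[ltRHS]invrK ltf_pV2 ?posrE
        ?invr_gt0//.
      exact: Num.Theory.truncnS_gt.
    have [_ /contrapT[y nUy /interior_subset ys]] := sI n Logic.I.
    apply: nUy; apply: dU; apply: ball_sym; apply: le_ball ys; exact: ltW.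
by exists (C n), U; split.
Qed.

Let approx_setC (A : set B) : approx A -> approx (setT `\` A).
Proof.
move=> aA e /aA[C [U [cC oU CA AU UC]]]; exists (~` U), (~` C); split.
- exact: open_closedC.
- exact: closed_openC.
- by move=> s nUs; split=> // /AU.
- by move=> s [_ nAs] /CA.
- rewrite (_ : ~` C `\` ~` U = U `\` C)//.
  by rewrite setDE setCK setIC setDE.
Qed.

Let approx_bigcup (A : nat -> set B) : (forall n, approx (A n)) ->
  approx (\bigcup_n A n).
Proof.
move=> aA e e0; have e2 : 0 < e / 2 by rewrite divr_gt0.
have /choice[CU hCU] n : exists CU : set H * set H, [/\ closed CU.1, open CU.2,
    CU.1 `<=` A n, A n `<=` CU.2 &
    (mu (CU.2 `\` CU.1 : set B) < (e / 2 / (2 ^ n.+1)%:R)%:E)%E].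
  have [|C [U ?]] := aA n (e / 2 / (2 ^ n.+1)%:R); last by exists (C, U).
  by rewrite divr_gt0// ltr0n expn_gt0.
pose U := \bigcup_n (CU n).2.
have oU : open U by apply: bigcup_open => n _; have [] := hCU n.
(* A countable union of closed sets need not be closed: finitely many are kept. In the limit the
   loss is at most e / 2, so it is below e at some finite rank. *)
pose C n : set H := \bigcup_(i in [set i | (i < n)%N]) (CU i).1.
have cC n : closed (C n).
  apply: closed_bigcup => [|i _]; last by have [] := hCU i.
  exact: finite_II.
have mD n : measurable ((CU n).2 `\` (CU n).1 : set B).
  have [cCn oUn _ _ _] := hCU n.
  by apply: measurableD; [exact: measurable_open|exact: measurable_closed].
have mUC n : measurable (U `\` C n : set B).
  by apply: measurableD; [exact: measurable_open|exact: measurable_closed].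
have [n nC] : exists n, (mu (U `\` C n : set B) < e%:E)%E.
  apply: decreasing_lt => //.
    move=> n k nk; apply/subsetPset => s [Us nCs]; split => // Cs; apply: nCs.
    move: Cs => [i /= ik Cs]; exists i => //=.
    exact: leq_trans ik nk.
  apply: (@le_lt_trans _ _ (\sum_(0 <= n <oo) mu ((CU n).2 `\` (CU n).1 : set
    B)))%E.
    apply: measure_sigma_subadditive => //; first exact: bigcap_measurable.
    move=> s sI; have [[n _ Us] _] := sI 0%N Logic.I.
    exists n => //; split => // Cs.
    have [_] := sI n.+1 Logic.I; apply.
    by exists n => /=.
  apply: (@le_lt_trans _ _ (e / 2)%:E); last first.
    by rewrite lte_fin ltr_pdivrMr// ltr_pMr// ltr1n.
  apply: le_trans (epsilon_trick0 xpredT (ltW e2)).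
  apply: lee_nneseries => // n _; have [_ _ _ _ h] := hCU n; exact: (ltW h).
exists (C n), U; split => //.
- move=> s [i _ Cs]; exists i => //.
  by have [_ _ h _ _] := hCU i; exact: h.
- by move=> s [i _ As]; exists i => //; have [_ _ _ h _] := hCU i; exact: h.
Qed.

(* [approx] defines a sigma-algebra containing the open sets. *)
Lemma regular_measure (A : set B) : measurable A -> forall e : R, 0 < e ->
  exists K U : set H, [/\ compact K, open U, K `<=` A, A `<=` U &
    (mu (U `\` K : set B) < e%:E)%E].
Proof.
move=> mA e e0; have e2 : 0 < e / 2 by rewrite divr_gt0.
have : approx A.
  have : sigma_algebra setT approx.
    split; [exact: approx_open open0|exact: approx_setC|exact: approx_bigcup].
  by move=> /smallest_sub; apply; [exact: approx_open|exact: mA].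
move=> /(_ _ e2)[C [U [cC oU CA AU UC]]].
(* Intersecting [C] with a long compact interval makes it compact, at the cost of the second e /
   2. *)
pose I n := [set s : H | - n%:R <= val s].
have cI n : compact (I n) by exact: compact_halfline_itv.
have clI n : closed (I n).
  rewrite (_ : I n = val @^-1` [set t | - n%:R <= t])//.
  by apply: closed_comp; [move=> s _;
    exact: continuous_val_halfline|exact: closed_ge].
have mI n : measurable (C `\` I n : set B).
  by apply: measurableD; exact: measurable_closed.
have [n nI] : exists n, (mu (C `\` I n : set B) < (e / 2)%:E)%E.
  apply: decreasing_lt => //.
    move=> n k nk; apply/subsetPset => s [Cs nIs]; split => // Is; apply: nIs.
    by apply: le_trans Is; rewrite lerN2 ler_nat.
  rewrite (_ : \bigcap_n _ = set0) ?measure0 ?lte_fin//.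
  apply/seteqP; split => // s sI.
  have [_ []] := sI (Num.truncn `|val s|).+1 Logic.I.
  rewrite /I /= lerNl (le_trans (ler_norm _))// normrN ltW//.
  exact: Num.Theory.truncnS_gt.
exists (I n `&` C), U; split => //.
- exact: compact_closedI.
- by move=> s [_ /CA].
have -> : e%:E = ((e / 2)%:E + (e / 2)%:E)%E by rewrite -EFinD -splitr.
apply: le_lt_trans (lteD UC nI).
have mUC : measurable (U `\` C : set B).
  by apply: measurableD; [exact: measurable_open|exact: measurable_closed].
apply: le_trans (measureU2 mu mUC (mI n)).
apply: le_measure; rewrite ?inE.
- apply: measurableD; first exact: measurable_open.
  by apply: measurableI; exact: measurable_closed.
- by apply: measurableU; [exact: mUC|exact: mI].
move=> s [Us nIC]; have [Cs|nCs] := pselect (C s); last by left.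
by right; split => // Is; exact: nIC.
Qed.

End regularity.

(** * Charges representing signed functionals *)

Section charge_representation.
Variable R : realType.
Local Notation H := (halfline R).
Local Notation B := (g_sigma_algebraType (@open H)).
Implicit Types (f g : H -> R) (s : H).

Lemma finite_measure_lty (mu : {finite_measure set B -> \bar R}) (A : set B) :
  measurable A -> (mu A < +oo)%E.
Proof. by move=> mA; rewrite ltey_eq fin_num_measure. Qed.

Lemma integrable_sbu (mu : {finite_measure set B -> \bar R}) f (A : set B) :
  measurable A -> sbu f -> mu.-integrable A (EFin \o f).
Proof.
move=> mA sf; apply: measurable_bounded_integrable => //.
- exact: finite_measure_lty.
- by apply: measurable_funTS; exact: measurable_sbu.
have [M M0 fM] := sbu_bound sf.
exists M; split; first exact: num_real.
by move=> N MN s _; exact/(le_trans (fM s))/ltW.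
Qed.

Lemma charge_integralD (nu : {charge set B -> \bar R}) f g : sbu f -> sbu g ->
  charge_integral nu (fun s => f s + g s) = charge_integral nu f +
    charge_integral nu g.
Proof.
move=> sf sg; rewrite /charge_integral !RintegralD//; try exact: integrable_sbu.
ring.
Qed.

Lemma total_variation_lty (nu : {charge set B -> \bar R}) :
  (Defs.total_variation nu setT < +oo)%E.
Proof.
rewrite /Defs.total_variation /charge_variation /= lte_add_pinfty//;
  exact: finite_measure_lty.
Qed.

Lemma regular_chargeT (nu : {charge set B -> \bar R}) : regular_charge nu.
Proof. exact: regular_measure (total_variation_lty nu). Qed.

Lemma Rintegral_le_mass (mu : {finite_measure set B ->
  \bar R}) f (W : set B) C :
  measurable W -> sbu f -> (forall s, `|f s| <= C) ->
  (forall s, ~ W s -> f s = 0) -> `|\int[mu]_s f s| <= C * fine (mu W).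
Proof.
move=> mW sf fC fW.
have -> : \int[mu]_s f s = \int[mu]_(s in W) f s.
  rewrite [RHS]Rintegral_mkcond; apply: eq_Rintegral => s _; rewrite patchE.
  by case: ifPn => // /negP; rewrite inE => /fW.
apply: le_trans (le_normr_Rintegral _ _) _ => //; first exact: integrable_sbu.
rewrite -Rintegral_cst//; apply: le_Rintegral => //.
- by have /integrable_norm := integrable_sbu mu mW sf.
- by apply: integrable_sbu => //; exact: sbu_cst.
Qed.

Lemma charge_integral_le_mass (nu : {charge set B -> \bar R}) f (W : set B) C :
  measurable W -> sbu f -> (forall s, `|f s| <= C) ->
  (forall s, ~ W s -> f s = 0) ->
  `|charge_integral nu f| <= C * fine (Defs.total_variation nu W).
Proof.
move=> mW sf fC fW; rewrite /charge_integral (le_trans (ler_normB _ _))//.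
rewrite /Defs.total_variation /charge_variation /= fineD ?fin_num_measure//=
  mulrDr.
by apply: lerD; exact: Rintegral_le_mass.
Qed.

(** [charge_integral] goes through a Hahn decomposition of [nu], which need not give back [mp] and
    [mn]. Adding crosswise turns jp - jn = mp - mn into an equality of positive measures, whose
    integrals can be compared. *)
Lemma riesz_charge (L : (H -> R) -> R) : tight_functional L ->
  exists nu : {charge set B -> \bar R}, forall f, sbu f ->
    charge_integral nu f = L f.
Proof.
move=> hL.
have [mp mpE] := riesz_positive (pos_functional_pos_part hL).
have [mn mnE] := riesz_positive (pos_functional_neg_part hL).
pose nu : {charge set B -> \bar R} :=
  cadd (charge_of_finite_measure mp) (cscale (-1) (charge_of_finite_measure
    mn)).
exists nu.
pose jp := jordan_pos (hahn nu); pose jn := jordan_neg (hahn nu).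
have mE A : measurable A -> (jp A + mn A = mp A + jn A)%E.
  move=> mA; have nuE : nu A = (mp A - mn A)%E by rewrite -mulN1e.
  have : nu A = (jp A - jn A)%E.
    by rewrite -(mulN1e (jn A)); exact: (jordan_decomp (hahn nu) mA).
  rewrite nuE.
  have := fin_num_measure mp A mA; have := fin_num_measure mn A mA.
  have : jp A \is a fin_num by exact: fin_num_measure.
  have : jn A \is a fin_num by exact: fin_num_measure.
  move: (jp A) (jn A) (mp A) (mn A) => [a| |] [b| |] [c| |] [d| |]//= _ _ _ _.
  by rewrite -!EFinD => -[?]; congr _%:E; lra.
have pos f : sbu f -> (forall s, 0 <= f s) -> charge_integral nu f = L f.
  move=> sf f0; rewrite /charge_integral -/jp -/jn.
  have mf : measurable_fun setT (EFin \o f : B -> \bar R).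
    by apply/measurable_EFinP; exact: measurable_sbu.
  have f0' s : setT s -> (0 <= (f s)%:E)%E by rewrite lee_fin.
  have : (\int[measure_add jp mn]_s (f s)%:E = \int[measure_add mp jn]_s (f
    s)%:E)%E.
    by apply: eq_measure_integral => A mA _;
      rewrite /measure_add/= /msum/= !big_ord_recr/= !big_ord0 !add0e;
        exact: mE.
  rewrite !ge0_integral_measure_add// mnE// mpE//.
  have fp : (\int[jp]_s (f s)%:E)%E \is a fin_num.
    by apply: integrable_fin_num => //; exact: integrable_sbu.
  have fn : (\int[jn]_s (f s)%:E)%E \is a fin_num.
    by apply: integrable_fin_num => //; exact: integrable_sbu.
  rewrite /Rintegral; move: fp fn.
  move: (\int[jp]_s (f s)%:E)%E (\int[jn]_s (f s)%:E)%E => [a| |] [b| |]//= _ _.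
  by rewrite -!EFinD => -[?]; lra.
(* A signed [f] becomes nonnegative once a constant is added, and the constant is itself covered by
   [pos]. *)
move=> f sf; have [C C0 fC] := sbu_bound sf.
have sC : sbu (fun=> C) by exact: sbu_cst.
have sfC := sbuD sf sC.
have fC0 s : 0 <= f s + C by have := fC s; rewrite ler_norml => /andP[? ?]; lra.
have := pos _ sfC fC0; rewrite charge_integralD// (tfD hL)// (pos (fun=> C))//.
  by move=> /addIr.
by move=> s; exact: ltW.
Qed.

End charge_representation.

(** * Atoms at 0 *)

Section atoms.
Variables (R : realType) (m : nat).
Local Notation H := (halfline R).
Local Notation V := 'cV[R]_m.
Local Notation BU := (BU R m).
Local Notation B := (g_sigma_algebraType (@open H)).
Implicit Types (x y z : BU) (f g : H -> R) (s : H).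

Lemma cV_entry_le (v : V) i : `|v i 0| <= `|v|.
Proof.
have -> : `|v| = mx_norm v by [].
by rewrite mx_normrE (le_bigmax _ (fun p => `|v p.1 p.2|) (i, 0)).
Qed.

Lemma cV_norm_le (v : V) C : 0 <= C -> (forall i, `|v i 0| <= C) -> `|v| <= C.
Proof.
move=> C0 vC; have -> : `|v| = mx_norm v by [].
rewrite mx_normrE; apply: bigmax_le => // -[i j] _ /=.
by rewrite (ord1 j).
Qed.

Definition window (n : nat) : set B := [set s : H | - n.+1%:R^-1 <= val s].

Lemma measurable_window n : measurable (window n).
Proof.
apply: measurable_closed.
rewrite (_ : window n = val @^-1` [set t | - n.+1%:R^-1 <= t])//.
by apply: closed_comp; [move=> s _;
  exact: continuous_val_halfline|exact: closed_ge].
Qed.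

Lemma window_le n k : (n <= k)%N -> window k `<=` window n.
Proof.
move=> nk s; apply: le_trans.
by rewrite lerN2 lef_pV2 ?posrE// ler_nat.
Qed.

Lemma bigcap_window : \bigcap_n window n = [set halfline0 R].
Proof.
apply/seteqP; split => [s sI|s -> n _]; last first.
  by rewrite /window /= oppr_le0 invr_ge0.
apply/val_inj/eqP; rewrite eq_le halfline_le0 /= leNgt; apply/negP => s0.
have := sI (Num.truncn (- val s)^-1) Logic.I; rewrite /window /= lerNl.
rewrite leNgt => /negP; apply; rewrite -[ltRHS]invrK ltf_pV2 ?posrE ?invr_gt0
  ?oppr_gt0//.
exact: Num.Theory.truncnS_gt.
Qed.

Lemma measurable_halfline0 : measurable ([set halfline0 R] : set B).
Proof. by rewrite -bigcap_window; apply: bigcap_measurable => // n _;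
  exact: measurable_window. Qed.

Lemma window_lt (mu : {measure set B ->
  \bar R}) (e : \bar R) : (mu setT < +oo)%E ->
  (mu [set halfline0 R] < e)%E -> exists n, (mu (window n) < e)%E.
Proof.
move=> muT mu0; apply: decreasing_lt => //; first exact: measurable_window.
  by move=> n k nk; apply/subsetPset; exact: window_le.
by rewrite bigcap_window.
Qed.

(** The normalization without measures: on functions supported near 0, [D] is evaluation at 0 up to
    a small relative error. It serves both the contraction and the atom of the dual operator. *)
Definition unit_atom (D : BU -> V) := forall e, 0 < e -> exists n : nat,
  forall x, zero_before n.+1%:R^-1 x -> `|D x - x (halfline0 R)| <= e * `|x|.

Lemma sbu_entry x i : sbu (fun s => x s i 0).
Proof.
split; first by exists `|x| => s; rewrite (le_trans (cV_entry_le _ _))// bu_ge.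
move=> e /(bu_unif x)[d d0 xd]; exists d => // s t /xd; apply: le_lt_trans.
by have := cV_entry_le (x s - x t) i; rewrite !mxE.
Qed.

Lemma normalized_unit_atom (D : BU -> V) : normalized D -> unit_atom D.
Proof.
move=> [nu [_ nu0 DE]] e e0.
(* A row has m entries; [m.+1] keeps the divisor nonzero when m = 0. *)
have em : 0 < e / m.+1%:R by rewrite divr_gt0.
have /choice[n hn] (p : 'I_m * 'I_m) : exists n,
    fine (Defs.total_variation (nu p.1 p.2) (window n)) < e / m.+1%:R.
  have [|n] := @window_lt (charge_variation (hahn (nu p.1 p.2)))
      (e / m.+1%:R)%:E (total_variation_lty _).
    by rewrite [X in (X < _)%E](nu0 p.1 p.2) lte_fin.
  move=> hn; exists n; rewrite -lte_fin fineK//.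
  apply: fin_num_measure; exact: measurable_window.
pose N := \max_p n p; exists N => x xN.
rewrite DE addrAC subrr sub0r normrN.
apply: cV_norm_le => [|i]; first by rewrite mulr_ge0// ltW.
rewrite mxE (le_trans (ler_norm_sum _ _ _))//.
apply: (@le_trans _ _ (\sum_(j < m) `|x| * (e / m.+1%:R))).
  apply: ler_sum => j _.
  have xW s : ~ window N s -> x s j 0 = 0.
    rewrite /window /= => /negP; rewrite -ltNge => /ltW sN.
    by rewrite xN// mxE.
  have xle s : `|x s j 0| <= `|x| by rewrite (le_trans (cV_entry_le _ _))//
    bu_ge.
  have := charge_integral_le_mass (nu i j) (measurable_window N) (sbu_entry x j)
    xle xW.
  move=> /le_trans; apply.
  rewrite ler_wpM2l// (le_trans _ (ltW (hn (i, j))))//=.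
  apply: fine_le; try by apply: fin_num_measure; exact: measurable_window.
  apply: le_measure; rewrite ?inE; try exact: measurable_window.
  by apply: window_le; rewrite /N (leq_bigmax (i, j)).
rewrite sumr_const card_ord -[_ *+ m]mulr_natr -[_ * _ * m%:R]mulrA [leRHS]mulrC
  ler_wpM2l//.
by rewrite mulrAC ler_pdivrMr// ler_wpM2l ?(ltW e0)// ler_nat.
Qed.

Section representation.
Variables (L : BU -> V) (hL : D1 L) (tL : tight L).

Let lift_fun f (j : 'I_m) s : V := f s *: delta_mx j 0.

Let lift_le f j C s : `|f s| <= C -> `|lift_fun f j s| <= C.
Proof.
move=> fC; apply: cV_norm_le => [|i]; first exact: le_trans fC.
rewrite !mxE eqxx andbT normrM; case: eqP => _; first by rewrite normr1 mulr1.
by rewrite normr0 mulr0 (le_trans _ fC).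
Qed.

Let lift_bu f j : sbu f -> lift_fun f j \in @is_bu R m.
Proof.
move=> [[M fM] fu]; apply/is_buP; split; first by exists M => s; exact: lift_le.
move=> e e0; have e2 : 0 < e / 2 by rewrite divr_gt0.
have [d d0 fd] := fu _ e2; exists d => // s t /fd st.
rewrite /lift_fun -scalerBl.
apply: (@le_lt_trans _ _ (e / 2));
  last by rewrite ltr_pdivrMr// ltr_pMr// ltr1n.
exact: (@lift_le (fun=> f s - f t) j _ s (ltW st)).
Qed.

(** The default 0, taken when the lifted function is not in [BU], makes [entry] defined on all
    functions. *)
Definition bu_lift f j : BU := insubd 0 (lift_fun f j).

Lemma bu_liftE f j s : sbu f -> bu_lift f j s = f s *: delta_mx j 0.
Proof. by move=> sf; rewrite /bu_lift -[bu_fun _]/(val _) insubdK//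
  lift_bu. Qed.

Lemma bu_lift_le f j C : sbu f -> (forall s, `|f s| <= C) ->
  `|bu_lift f j| <= C.
Proof. by move=> sf fC; apply: bu_le => s; rewrite bu_liftE//;
  exact: lift_le. Qed.

Definition entry i j f : R := L (bu_lift f j) i 0.

Lemma tight_functional_entry i j : tight_functional (entry i j).
Proof.
split.
- move=> f g sf sg; rewrite /entry (_ : bu_lift _ j = bu_lift f j + bu_lift g
  j).
    by rewrite D1D// mxE.
  apply: bu_ext => s; rewrite -[RHS]/(bu_lift f j s + bu_lift g j s)
    !bu_liftE//.
    by rewrite scalerDl.
  exact: sbuD.
- move=> a f sf; rewrite /entry (_ : bu_lift _ j = a *: bu_lift f j).
    by rewrite D1Z// mxE.
  apply: bu_ext => s; rewrite -[RHS]/(a *: bu_lift f j s) !bu_liftE//.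
    by rewrite scalerA.
  exact: sbuZ.
- have [M M0 LM] := D1_bound hL; exists M => // f C sf fC.
  rewrite (le_trans (cV_entry_le _ _))// (le_trans (LM _))//
    ler_wpM2l ?(ltW M0)//.
  exact: bu_lift_le.
- move=> e e0; have [T T0 LT] := tL e0; exists T => // f sf f1 fT.
  rewrite (le_trans (cV_entry_le _ _))// (le_trans (LT _ _))//.
    by move=> s sT; rewrite bu_liftE// fT// scale0r.
  by rewrite ler_piMr ?(ltW e0)//; exact: bu_lift_le.
Qed.

Lemma entry_sum x i : L x i 0 = \sum_j entry i j (fun s => x s j 0).
Proof.
have {1}-> : x = \sum_j bu_lift (fun s => x s j 0) j.
  apply: bu_ext => s.
  have -> : (\sum_j bu_lift (fun s =>
    x s j 0) j) s = \sum_j bu_lift (fun s => x s j 0) j s.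
    exact: (big_morph (fun y : BU => y s)).
  rewrite {1}[x s]matrix_sum_delta; apply: eq_bigr => j _.
  by rewrite big_ord1 bu_liftE//; exact: sbu_entry.
have -> : L (\sum_j bu_lift (fun s =>
  x s j 0) j) = \sum_j L (bu_lift (fun s => x s j 0) j).
  exact: (big_morph L (D1D hL) (D1_0 hL)).
by rewrite summxE.
Qed.

(** The values on scalar functions are kept beside the representation: they are evaluated on bumps
    to find the atoms at 0. *)
Lemma riesz_matrix : exists mu : 'I_m -> 'I_m -> {charge set B -> \bar R},
  (forall x, L x = mx_integral mu x) /\
  forall i j f, sbu f -> charge_integral (mu i j) f = entry i j f.
Proof.
have /choice[mu hmu] (p : 'I_m * 'I_m) : exists nu : {charge set B -> \bar R},
    forall f, sbu f -> charge_integral nu f = entry p.1 p.2 f.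
  exact: riesz_charge (tight_functional_entry _ _).
exists (fun i j => mu (i, j)); split => [x|i j f sf]; last exact: (hmu (i, j)).
apply/colP => i; rewrite entry_sum mxE; apply: eq_bigr => j _.
by rewrite (hmu (i, j))//; exact: sbu_entry.
Qed.

End representation.

End atoms.

(** * Bumps that detect the atom at 0 *)

Section bump.
Variables (R : realType).
Local Notation H := (halfline R).
Local Notation B := (g_sigma_algebraType (@open H)).
Implicit Types (f g : H -> R) (s : H).

Definition bump (n : nat) s : R := Num.max 0 (1 + n.+1%:R * val s).

Lemma bump_ge0 n s : 0 <= bump n s.
Proof. by rewrite le_max lexx. Qed.

Lemma bump_le1 n s : bump n s <= 1.
Proof. by rewrite ge_max ler01 gerDl mulr_ge0_le0 ?halfline_le0. Qed.

Lemma bump_0 n : bump n (halfline0 R) = 1.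
Proof. by rewrite /bump /= mulr0 addr0 max_r. Qed.

Lemma bump0 n s : val s <= - n.+1%:R^-1 -> bump n s = 0.
Proof.
move=> sn; rewrite /bump max_l//.
have : n.+1%:R * val s <= n.+1%:R * - n.+1%:R^-1 by rewrite ler_wpM2l.
by rewrite mulrN divff//; lra.
Qed.

Lemma sbu_bump n : sbu (bump n).
Proof.
apply: (@sbu_lip _ _ 1 n.+1%:R) => // [s|s t].
  by rewrite ger0_norm ?bump_ge0 ?bump_le1.
rewrite (le_trans (maxr_lip _ _ _))// opprD addrACA subrr add0r -mulrBr.
by rewrite normrM ger0_norm.
Qed.

(** The integral is squeezed between the mass of {0} and that of [window n], which decreases to
    it. *)
Lemma Rintegral_bump (mu : {finite_measure set B -> \bar R}) e : 0 < e ->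
  exists N : nat, forall n, (N <= n)%N ->
    `|\int[mu]_s bump n s - fine (mu [set halfline0 R])| <= e.
Proof.
move=> e0; have m0 := @measurable_halfline0 R.
have fin0 : mu [set halfline0 R] \is a fin_num by exact: fin_num_measure.
have [|N hN] := @window_lt R mu (mu [set halfline0 R] + e%:E)
  (finite_measure_lty mu measurableT).
  by rewrite lteDl// lte_fin.
exists N => n Nn; have mW := @measurable_window R.
have le1 : `|\int[mu]_s bump n s| <= 1 * fine (mu (window n)).
  apply: Rintegral_le_mass => //; first exact: sbu_bump.
    by move=> s; rewrite ger0_norm ?bump_ge0 ?bump_le1.
  move=> s; rewrite /window /= => /negP; rewrite -ltNge => /ltW sn.
  exact: bump0.
have le2 : fine (mu (window n)) <= fine (mu [set halfline0 R]) + e.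
  rewrite -lee_fin EFinD !fineK ?fin_num_measure//.
  apply: le_trans (ltW hN); apply: le_measure; rewrite ?inE//.
  exact: window_le.
have le3 : fine (mu [set halfline0 R]) <= \int[mu]_s bump n s.
  have ib : mu.-integrable setT (EFin \o bump n) by apply: integrable_sbu =>
    //; exact: sbu_bump.
  apply: fine_le => //; first exact: integrable_fin_num.
  have -> : mu [set halfline0 R] = (\int[mu]_(s in [set halfline0 R]) (bump n
    s)%:E)%E.
    rewrite (eq_integral (cst 1%E)) ?integral_cst ?mul1e// => s.
    by rewrite inE => /= ->; rewrite bump_0.
  apply: ge0_subset_integral => //.
    by have /integrableP[] := ib.
  by move=> s _; rewrite lee_fin bump_ge0.
have := ler_norm (\int[mu]_s bump n s).
by rewrite ler_norml => ?; apply/andP; split; lra.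
Qed.

Lemma charge_integral_bump (nu : {charge set B -> \bar R}) e : 0 < e ->
  exists N : nat, forall n, (N <= n)%N ->
    `|charge_integral nu (bump n) - fine (nu [set halfline0 R])| <= e.
Proof.
move=> e0; have e2 : 0 < e / 2 by rewrite divr_gt0.
have m0 := @measurable_halfline0 R.
pose jp := jordan_pos (hahn nu); pose jn := jordan_neg (hahn nu).
have [N1 h1] := Rintegral_bump jp e2; have [N2 h2] := Rintegral_bump jn e2.
exists (maxn N1 N2) => n; rewrite geq_max => /andP[/h1 {}h1 /h2 {}h2].
have -> : fine (nu [set halfline0 R]) =
    fine (jp [set halfline0 R]) - fine (jn [set halfline0 R]).
  rewrite -fineB; try exact: fin_num_measure.
  congr fine; rewrite -mulN1e; exact: (jordan_decomp (hahn nu) m0).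
rewrite /charge_integral -/jp -/jn.
rewrite [X in `|X|](_ : _ = (\int[jp]_s bump n s - fine (jp [set halfline0 R]))
  -
  (\int[jn]_s bump n s - fine (jn [set halfline0 R]))); last by ring.
by rewrite (le_trans (ler_normB _ _))// [leRHS]splitr lerD.
Qed.

End bump.

(** * The atom of the dual operator *)

Section dual_atom.
Variables (R : realType) (m : nat).
Local Notation H := (halfline R).
Local Notation V := 'cV[R]_m.
Local Notation BU := (BU R m).
Local Notation B := (g_sigma_algebraType (@open H)).

Lemma dual_D3 (D L : BU -> V) (hD : D1 D) (hL : D1 L) : unit_atom D ->
  tight L ->
  cancel (hat hL) (hat hD) -> D3 L.
Proof.
move=> aD tL LD; have [mu [muL muE]] := riesz_matrix hL tL.
exists mu; split => //; first by move=> i j; exact: regular_chargeT.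
suff -> : \matrix_(i, j) fine (mu i j [set halfline0 R]) = 1%:M by rewrite det1
  oner_neq0.
apply/matrixP => i j; rewrite !mxE; apply/eqP.
rewrite -subr_eq0 -normr_le0; apply/ler_addgt0Pl => e e0; rewrite addr0.
have e2 : 0 < e / 2 by rewrite divr_gt0.
have [M M0 LM] := D1_bound hL.
have eM : 0 < e / 2 / M by rewrite divr_gt0.
have [N1 h1] := charge_integral_bump (mu i j) e2.
have [N2 h2] := aD _ eM.
pose n := maxn N1 N2; have {}h1 := h1 n (leq_maxl _ _).
rewrite muE in h1; last exact: sbu_bump.
pose g : BU := bu_lift (bump n) j; pose y := hat hL g.
have g1 : `|g| <= 1.
  apply: bu_lift_le; first exact: sbu_bump.
  by move=> s; rewrite ger0_norm ?bump_ge0 ?bump_le1.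
have yM : `|y| <= M.
  apply: bu_le => s; rewrite hatE (le_trans (LM _))// ler_piMr ?(ltW M0)//.
  by rewrite (le_trans (bu_shift_le _ _)).
have ys : zero_before N2.+1%:R^-1 y.
  move=> s sn; rewrite hatE (_ : bu_shift g s = 0) ?D1_0//.
  apply: bu_ext => u; rewrite bu_shiftE /g bu_liftE; last exact: sbu_bump.
  rewrite bump0 ?scale0r// val_add (@le_trans _ _ (val s))//.
    by rewrite gerDl halfline_le0.
  by rewrite (le_trans sn)// lerN2 lef_pV2 ?posrE// ler_nat ltnS leq_maxr.
(* Here D y = g(0) is the j-th basis vector and y(0) = L g, so the unit atom of [D] bounds their
   difference by (e / 2 / M) |y|, at most e / 2. *)
have := h2 _ ys; rewrite -(hat_0 hD) LD {1}/g bu_liftE; last exact: sbu_bump.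
rewrite bump_0 scale1r hat_0 => h3.
have {}h3 : `|delta_mx j 0 - L g| <= e / 2.
  by rewrite (le_trans h3)// -ler_pdivlMl ?divr_gt0// invf_div divfK ?gt_eqF.
have := le_trans (cV_entry_le _ i) h3;
  rewrite !mxE eqxx andbT -/(entry L i j (bump n)) => h4.
rewrite [X in `|X|](_ : _ = - (entry L i j (bump n) - fine (mu i j [set
  halfline0 R])) -
   ((i == j)%:R - entry L i j (bump n))); last by ring.
by rewrite (le_trans (ler_normB _ _))// normrN [leRHS]splitr lerD.
Qed.

End dual_atom.

Theorem proposition3p10 (R : realType) (m : nat) (D : BU R m -> 'cV[R]_m)
    (D_1 : D1 D) (D_2 : D2 D) (D_3 : D3 D)
    (D_normalized : normalized D) (D_stable : stable D) :
  exists E : BU R m -> BU R m,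
    [/\ cancel (hat D_1) E, cancel E (hat D_1) &
        let Dstar := fun x : BU R m => E x (halfline0 R) in
        [/\ stable Dstar, D1 Dstar, D2 Dstar & D3 Dstar]].
Proof.
have tD := D2_tight D_1 D_2.
have aD := normalized_unit_atom D_normalized.
have h2 : 0 < 2^-1 :> R by rewrite invr_gt0.
have [n Dd] := aD _ h2.
have d0 : 0 < n.+1%:R^-1 :> R by rewrite invr_gt0.
have [c [_ c_ge0 c0 c_stable]] := D_stable.
have [K K0 hatK] := hat_bounded_below D_1 d0 Dd c0 c_stable c_ge0.
have cn0 : c n%:R @[n --> \oo] --> 0 by exact: (cvg_comp _ _ (@cvgr_idn R)).
have [L [hL [tL LD]]] : exists L (hL : D1 L), tight L /\
  cancel (hat hL) (hat D_1).
  apply: (dual_functional tD K0 hatK (hat_solve D_1 d0 Dd) _ cn0) => k;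
    first exact: c_ge0.
  move=> w; exact: (homogeneous_le d0 Dd c_stable (ler0n R k) (c_ge0 _ (ler0n R
    k))).
exists (hat hL); split => //.
  (* [hat hL] is so far a right inverse of D^; injectivity of D^ makes it two-sided. *)
  by move=> x; apply: (hat_inj hatK); rewrite LD.
have -> : (fun x => hat hL x (halfline0 R)) = L by apply/funext => x;
  exact: hat_0.
split=> //.
- exact: dual_stable tD LD.
- exact: tight_D2.
- exact: dual_D3 aD tL LD.
Qed.
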